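(* Let $\{X_n\}$ be a (stationary) binary renewal process with run-length distribution $\{p_k\}_{k\ge 0}$. Assume $\sum_{k=0}^{\infty} k^{\alpha+1}p_k<\infty$ for some $\alpha>1$. Let $0<\gamma<1/3$. Let $\lambda_n^*$ be the stopping times and $h_n^*(X_0,\ldots,X_{\lambda_n^*})$, $\hat p_l^*(X_0,\ldots,X_{\lambda_n^*})$ ($l\ge0$) the estimators defined (with this $\gamma$) in the context. Then, almost surely, $$\lim_{n\to\infty}\frac{\lambda_n^*}{n}=1,$$ $$\lim_{n\to\infty}\bigl|h_n^*(X_0,\ldots,X_{\lambda_n^*})-\theta_{\lambda_n^*}\bigr|=0,$$ and $$\lim_{n\to\infty}\sum_{l=0}^{\infty}\left|\hat p_l^*(X_0,\ldots,X_{\lambda_n^*})-\frac{p_{l+\tau(X_0^{\lambda_n^*})}}{\sum_{i=\tau(X_0^{\lambda_n^*})}^{\infty}p_i}\right|=0.$$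
   Context: **Binary renewal process.** Let $\{p_k\}_{k=0}^\infty$ be a probability distribution on $\{0,1,2,\ldots\}$ with $\mu=\sum_{k}kp_k<\infty$. Consider the Markov chain $\{M_n\}$ on $\{0,1,2,\ldots\}$ with transition probabilities $p_{i,i-1}=1$ for $i\ge1$ and $p_{0,i}=p_i$ for $i\ge 0$, started from its unique stationary distribution (which gives mass $1/(1+\mu)$ to state $0$). The binary renewal process is $X_n=0$ if $M_n=0$ and $X_n=1$ otherwise. It is stationary, and may be regarded as a two-sided process $\{X_n\}_{n\in\mathbb Z}$; $p_k$ is the conditional probability that a run of exactly $k$ ones follows a given zero. **Notation.** $X_i^j=(X_i,\ldots,X_j)$. All logarithms are to base $2$. - $\psi=\min\{t\ge0: X_t=0\}$ is the position of the first zero. - For $n\ge\psi$, $\tau(X_0^n)$ is the $t\ge0$ such that $X_{n-t}=0$ and $X_i=1$ for all $n-t<i\le n$ (time since the last zero). - $\sigma_i=\max\{l\ge0: X_j=1\text{ for all } i<j\le i+l\}$. - $\theta_n=E(\sigma_n\mid X_0^n)$. On $\{n\ge\psi\}$ one has $\theta_n=\dfrac{\sum_{k=0}^\infty k\,p_{k+\tau(X_0^n)}}{\sum_{k=\tau(X_0^n)}^\infty p_k}$. $\theta_{\lambda_n^*}$ denotes $\theta_m$ evaluated at the random index $m=\lambda_n^*$. **Stopping times and estimators** (depending on $\gamma\in(0,1)$). $\lambda_0^*=\psi$ and for $n\ge1$, $\lambda_n^*$ is the smallest integer $t>\lambda_{n-1}^*$ such that - there exists an integer $i$ with $\psi<i<\log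 t$ and $\tau(X_0^i)=\tau(X_0^t)$, and - $|\{\log t\le j<2^{\lfloor\log t\rfloor}:\tau(X_0^j)=\tau(X_0^t)\}|\ge 2^{\lfloor\log t\rfloor(1-\gamma)}$. For $n\ge1$, $$\kappa_n^*=\min\{K:|\{\lfloor\log\lambda_n^*\rfloor<j\le K:\tau(X_0^j)=\tau(X_0^{\lambda_n^*})\}|=\lceil2^{\lfloor\log\lambda_n^*\rfloor(1-\gamma)}\rceil\},$$ $$h_n^*(X_0,\ldots,X_{\lambda_n^*})=\frac1{\lceil2^{\lfloor\log\lambda_n^*\rfloor(1-\gamma)}\rceil}\sum_{i=\lfloor\log\lambda_n^*\rfloor+1}^{\kappa_n^*}I_{\{\tau(X_0^i)=\tau(X_0^{\lambda_n^*})\}}\,\sigma_i,$$ $$\hat p_l^*(X_0,\ldots,X_{\lambda_n^*})=\frac1{\lceil2^{\lfloor\log\lambda_n^*\rfloor(1-\gamma)}\rceil}\sum_{i=\lfloor\log\lambda_n^*\rfloor+1}^{\kappa_n^*}I_{\{\tau(X_0^i)=\tau(X_0^{\lambda_n^*}),\ \sigma_i=l\}},\qquad l\ge0.$$ Here $I$ denotes the indicator function. *)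

(* Defs.v *)
(* MathComp-Analysis development. *)
From HB Require Import structures.
From mathcomp Require Import all_boot all_order all_algebra.
From mathcomp Require Import all_classical all_reals all_analysis.

Set Implicit Arguments.
Unset Strict Implicit.
Unset Printing Implicit Defensive.

Import Order.TTheory GRing.Theory Num.Theory.
Import numFieldNormedType.Exports.

Local Open Scope classical_set_scope.
Local Open Scope ring_scope.

Definition prob_mass {R : realType} (p : nat -> R) : Prop :=
  (forall k, 0 <= p k) /\ (\sum_(0 <= k <oo) (p k)%:E = 1)%E.

Definition stationary_law {R : realType} (Q : nat -> nat -> R) (q : nat -> R)
    : Prop :=
  prob_mass q /\
  forall j, (\sum_(0 <= i <oo) (q i * Q i j)%:E = (q j)%:E)%E.

(* Initial law [q] and one-step transition probabilities [Q]; the conditional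
   probability given the past is multiplied out, so that null histories need
   no separate treatment. *)
Definition markov_chain {d : measure_display} {T : measurableType d}
    {R : realType} (P : probability T R) (q : nat -> R) (Q : nat -> nat -> R)
    (M : nat -> {RV P >-> nat}) : Prop :=
  (forall i, P [set w | M 0%N w = i] = (q i)%:E) /\
  forall (n : nat) (x : nat -> nat),
    P [set w | forall k, (k <= n.+1)%N -> M k w = x k] =
    (P [set w | forall k, (k <= n)%N -> M k w = x k]
       * (Q (x n) (x n.+1))%:E)%E.

Definition renewal_trans {R : realType} (p : nat -> R) (i j : nat) : R :=
  if i is i'.+1 then (j == i')%:R else p j.

(* The symbols 0 and 1 are [false] and [true]. *)
Definition binary_renewal {d : measure_display} {T : measurableType d}
    {R : realType} (P : probability T R) (p : nat -> R)
    (X : nat -> T -> bool) : Prop :=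
  exists (M : nat -> {RV P >-> nat}) (q : nat -> R),
    [/\ stationary_law (renewal_trans p) q,
        markov_chain q (renewal_trans p) M
      & forall n w, X n w = (M n w != 0%N)].

(* [Z] is a version of the conditional expectation of [Y] given the
   sub-sigma-algebra [G]. *)
Definition cond_expectation {d : measure_display} {T : measurableType d}
    {R : realType} (P : probability T R) (G : set (set T)) (Y Z : T -> R)
    : Prop :=
  [/\ forall B : set R, measurable B -> G (Z @^-1` B),
      P.-integrable setT (EFin \o Z)
    & forall A, G A -> (\int[P]_(w in A) (Z w)%:E = \int[P]_(w in A) (Y w)%:E)%E].

(* The sigma-algebra generated by X_0, ..., X_n; every subset of the finite
   set of words of length n + 1 is measurable. *)
Definition history {T : Type} (X : nat -> T -> bool) (n : nat) : set (set T) :=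
  preimage_set_system setT
    (fun w => [ffun i : 'I_n.+1 => X i w] : {ffun 'I_n.+1 -> bool}) setT.

(* Junk value 0 when [A] is empty. *)
Definition least (A : set nat) : nat :=
  xget 0%N [set t | A t /\ forall s, A s -> (t <= s)%N].

(* Below, [x : nat -> bool] is a sample path x_0, x_1, ... *)

Definition psi (x : nat -> bool) : nat := least [set t | x t = false].

(* At most one [t] qualifies; junk value 0 if x_0, ..., x_n are all 1. *)
Definition tau (x : nat -> bool) (n : nat) : nat :=
  xget 0%N [set t | [/\ (t <= n)%N, x (n - t)%N = false
    & forall i, (n - t < i <= n)%N -> x i = true]].

Definition ones_after (x : nat -> bool) (i l : nat) : Prop :=
  forall j, (i < j <= i + l)%N -> x j = true.

(* The largest [l] with [ones_after x i l]; junk value 0 if there is none,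
   i.e. if x_j = 1 for all j > i. *)
Definition sigma (x : nat -> bool) (i : nat) : nat :=
  xget 0%N [set l | ones_after x i l /\
                    forall l', ones_after x i l' -> (l' <= l)%N].

Definition log2 {R : realType} (y : R) : R := ln y / ln 2.

Definition flog (R : realType) (t : nat) : nat := Num.truncn (@log2 R t%:R).

(* 2 ^ (floor (log t) * (1 - gamma)) *)
Definition quota {R : realType} (gamma : R) (t : nat) : R :=
  2 `^ ((flog R t)%:R * (1 - gamma)).

Definition admissible {R : realType} (gamma : R) (x : nat -> bool) (t : nat)
    : Prop :=
  (exists i : nat,
     [/\ (psi x < i)%N, i%:R < @log2 R t%:R & tau x i = tau x t]) /\
  quota gamma t <=
    #|[pred j : 'I_(2 ^ flog R t) |
        (@log2 R t%:R <= j%:R) && (tau x j == tau x t)]|%:R.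

(* If a stopping time were infinite, [least] would return 0 and the recursion
   would restart from 0, so [lambda_star gamma x n / n] could not tend to 1:
   the junk value never makes a convergence statement about this ratio true. *)
Fixpoint lambda_star {R : realType} (gamma : R) (x : nat -> bool) (n : nat)
    : nat :=
  if n is n'.+1 then
    least [set t | (lambda_star gamma x n' < t)%N /\ admissible gamma x t]
  else psi x.

(* In the next three definitions [t] stands for the value of the stopping
   time. *)
Definition kappa_star {R : realType} (gamma : R) (x : nat -> bool) (t : nat)
    : nat :=
  least [set K : nat |
    (#|[pred j : 'I_K.+1 | (flog R t < j)%N && (tau x j == tau x t)]|%:Z
       = Num.ceil (quota gamma t))%R].

Definition h_star {R : realType} (gamma : R) (x : nat -> bool) (t : nat) : R :=
  ((Num.ceil (quota gamma t))%:~R)^-1 *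
  \sum_((flog R t).+1 <= i < (kappa_star gamma x t).+1)
     (tau x i == tau x t)%:R * (sigma x i)%:R.

Definition phat_star {R : realType} (gamma : R) (x : nat -> bool) (t l : nat)
    : R :=
  ((Num.ceil (quota gamma t))%:~R)^-1 *
  \sum_((flog R t).+1 <= i < (kappa_star gamma x t).+1)
     ((tau x i == tau x t) && (sigma x i == l))%:R.

(* \sum_(i >= k) p_i as a real number. *)
Definition tail_sum {R : realType} (p : nat -> R) (k : nat) : R :=
  fine (\sum_(k <= i <oo) (p i)%:E)%E.

(* Main.v *)
(* Write sigma_i = M_{i+1} for the run following i, and call age the time tau
   since the last zero. At each zero of the chain a fresh run with law p opens,
   so a sum over the zeros i of a_i g(M_{i+1}), with a_i depending on the past
   and g of p-mean 0, is a martingale and its square has mean at most the sum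
   of the means of a_i^2 g(M_{i+1})^2. Only a finite second moment of p is
   needed, and stationarity plays no role.
   - With a_i = 1 this gives a law of large numbers along the times 2^m. Ages
     larger than S have density O(1/S), while each age of positive probability
     has positive density, so that the times with this age are eventually all
     admissible. Hence inadmissible times have density 0 and lambda_n / n -> 1.
   - Let m = floor(log t) and s = tau(t). The n = ceil(2^(m(1-gamma))) sampled
     positions of age s after m form such a sum, with a_i the indicator that i
     is sampled and that age s has already occurred up to time m. Summing
     (l + 1) |phat_l - q_l| over l and over s <= m, with q the conditional law
     of the run at age s, one gets a mean that is geometrically small in m:
     frequencies of l < L are bounded in quadratic mean, the others by their
     mass, since age s occurs before m with probability at most (m + 1) times
     the tail of p at s. So the weighted l^1 error tends to 0 almost surely,
     and it dominates both the l^1 error and the error of the mean. *)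

Require Import Defs.
From HB Require Import structures.
From mathcomp Require Import all_boot all_order all_algebra.
From mathcomp Require Import all_classical all_reals all_analysis.
From mathcomp Require Import measurable_realfun.
From mathcomp Require Import zify ring lra.

Set Implicit Arguments.
Unset Strict Implicit.
Unset Printing Implicit Defensive.

Import Order.TTheory GRing.Theory Num.Theory.
Import numFieldNormedType.Exports.

Local Open Scope classical_set_scope.
Local Open Scope ring_scope.

(** * Markov property *)

Lemma nneseriesZr (R : realType) (f : nat -> \bar R) (c : \bar R) :
  (forall k, 0 <= f k)%E -> c \is a fin_num ->
  (\sum_(k <oo) (f k * c) = (\sum_(k <oo) f k) * c)%E.
Proof.
move=> f0 cf; rewrite muleC -(fineK cf) -(@nneseriesZl _ _ xpredT)//.
by apply: eq_eseriesr => k _; rewrite muleC.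
Qed.

Section countable_partition.
Context d (T : measurableType d) (R : realType).
Local Open Scope ereal_scope.

(** Applied to [path_code], this reduces integrals of adapted functions to atoms on which they are
    constant. *)
Lemma ge0_integral_fibers (mu : {measure set T -> \bar R}) (D : set T)
    (N : T -> nat) (f : T -> \bar R) :
  measurable D -> measurable_fun setT N -> measurable_fun setT f ->
  (forall w, 0 <= f w) ->
  \int[mu]_(w in D) f w =
  \sum_(k <oo) \int[mu]_(w in D `&` N @^-1` [set k]) f w.
Proof.
move=> mD mN mf f0.
have DE : D = \bigcup_k (D `&` N @^-1` [set k]).
  apply/seteqP; split=> [w Dw|w [k _ []]//]; by exists (N w).
rewrite [in LHS]DE ge0_integral_bigcup//.
- move=> k; apply: measurableI => //.
  by rewrite -[X in measurable X]setTI; exact: mN.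
- exact: measurable_funS mf.
- by move=> i j _ _ [w [[_ /= <-] [_ /= <-]]].
Qed.

End countable_partition.

Section markov_property.
Context d (T : measurableType d) (R : realType) (P : probability T R).
Variables (Q : nat -> nat -> R) (q : nat -> R) (M : nat -> {RV P >-> nat}).

(** Dependence on the path up to [J] is stated pointwise: there are only countably many such paths,
    so this already forces measurability ([adapted_measurable]). *)
Definition adapted {S : Type} (J : nat) (F : T -> S) : Prop :=
  forall w w', (forall i, (i <= J)%N -> M i w = M i w') -> F w = F w'.

Definition path_code (J : nat) (w : T) : nat :=
  pickle [seq M i w | i <- iota 0 J.+1].

Lemma path_codeP J w w' :
  path_code J w = path_code J w' <->
  forall i, (i <= J)%N -> M i w = M i w'.
Proof.
split=> [/(pcan_inj pickleK)/eq_in_map + i iJ|ww'].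
  by apply; rewrite mem_iota; lia.
congr pickle; apply/eq_in_map => i; rewrite mem_iota => iJ; apply: ww'; lia.
Qed.

Lemma path_code_fiber J w :
  path_code J @^-1` [set path_code J w] =
  [set v | forall i, (i <= J)%N -> M i v = M i w].
Proof. by apply/seteqP; split=> v /= /path_codeP. Qed.

Lemma measurable_path J (x : nat -> nat) :
  measurable [set w | forall i, (i <= J)%N -> M i w = x i].
Proof.
rewrite (_ : mkset _ = \bigcap_(i in [set i | (i <= J)%N]) (M i @^-1` [set x i])).
  apply: bigcap_measurable => [|i _]; first by exists 0%N.
  by rewrite -[X in measurable X]setTI; exact: measurable_funPT.
by apply/seteqP; split=> w /= h i; apply: h.
Qed.

Lemma measurable_path_code J : measurable_fun setT (path_code J).
Proof.
move=> _ Y _; rewrite setTI.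
rewrite (_ : _ @^-1` _ = \bigcup_(c in Y) (path_code J @^-1` [set c])); last first.
  by apply/seteqP; split=> [w Yw|w [c Yc /= wc]]; [exists (path_code J w)|rewrite /preimage/= wc].
apply: bigcup_measurable => c _.
have [[w <-]|nw] := pselect (exists w, path_code J w = c).
  by rewrite path_code_fiber; exact: measurable_path.
rewrite (_ : _ @^-1` _ = set0)//; apply/seteqP; split=> // w /= wc.
by apply: nw; exists w.
Qed.

(** [F] factors through the [nat]-valued [path_code J], so each preimage under [F] is the preimage
    of a set of codes, and every set of codes is measurable. *)
Lemma adapted_measurable d' (S : measurableType d') J (F : T -> S) :
  adapted J F -> measurable_fun setT F.
Proof.
move=> aF _ Y _; rewrite setTI.
rewrite (_ : F @^-1` Y = setT `&` path_code J @^-1` (path_code J @` (F @^-1` Y))).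
  exact: measurable_path_code.
rewrite setTI; apply/seteqP; split=> [w Yw|w /= [v Yv /path_codeP vw]].
  by exists w.
by rewrite /preimage/= -(aF _ _ vw).
Qed.

Hypothesis markovM : markov_chain q Q M.

Lemma markov_atom J w k :
  P ([set v | forall i, (i <= J)%N -> M i v = M i w] `&`
     M J.+1 @^-1` [set k]) =
  (P [set v | forall i, (i <= J)%N -> M i v = M i w] * (Q (M J w) k)%:E)%E.
Proof.
pose x i := if (i <= J)%N then M i w else k.
have xE i : (i <= J)%N -> x i = M i w by rewrite /x => ->.
have xJ : x J.+1 = k by rewrite /x ltnn.
rewrite (_ : [set v | _] = [set v | forall i, (i <= J)%N -> M i v = x i]); last first.
  by apply/seteqP; split=> v /= h i iJ; move: (h i iJ); rewrite xE.
rewrite -{1}(xE J)// -{2}xJ -markovM.2.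
congr (P _); apply/seteqP; split=> v /=.
  move=> [h1 h2] i; rewrite leq_eqVlt => /predU1P[->|]; first by rewrite xJ.
  by rewrite ltnS; exact: h1.
by move=> h; split=> [i iJ|]; rewrite h// ltnW.
Qed.


(** Integrates out one step of the chain: on an atom of [path_code J] each [Psi^~ k] and [M J] are
    constant, and [markov_atom] gives the law of [M J.+1] there. *)
Lemma markov_integral J (Psi : T -> nat -> \bar R) :
  (forall i k, 0 <= Q i k) ->
  (forall w k, 0 <= Psi w k)%E -> (forall k, adapted J (Psi^~ k)) ->
  (\int[P]_w Psi w (M J.+1 w) =
   \int[P]_w \sum_(k <oo) (Psi w k * (Q (M J w) k)%:E))%E.
Proof.
move=> Q0 Psi0 aPsi.
have S0 w : (0 <= \sum_(k <oo) (Psi w k * (Q (M J w) k)%:E))%E.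
  by apply: nneseries_ge0 => k _ _; rewrite mule_ge0// lee_fin.
rewrite (ge0_integral_fibers _ measurableT (measurable_path_code J))//; last first.
  apply: (@adapted_measurable _ _ J.+1) => w w' ww'.
  rewrite ww'//; apply: (aPsi _) => i iJ; apply: ww'; exact: leqW.
rewrite [RHS](ge0_integral_fibers _ measurableT (measurable_path_code J))//; last first.
  apply: (@adapted_measurable _ _ J) => w w' ww'.
  by apply: eq_eseriesr => k _; rewrite ww'//; congr (_ * _)%E; exact: aPsi.
apply: eq_eseriesr => c _; rewrite !setTI.
have [[w <-]|nw] := pselect (exists w, path_code J w = c); last first.
  rewrite (_ : _ @^-1` _ = set0) ?integral_set0//; apply/seteqP; split=> // w /= wc.
  by apply: nw; exists w.
rewrite path_code_fiber; set A := mkset _.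
have mA : measurable A by exact: measurable_path.
rewrite (ge0_integral_fibers _ mA (measurable_funPT (M J.+1)))//; last first.
  apply: (@adapted_measurable _ _ J.+1) => v v' vv'.
  rewrite vv'//; apply: (aPsi _) => i iJ; apply: vv'; exact: leqW.
transitivity (\sum_(k <oo) Psi w k * (Q (M J w) k)%:E * P A)%E.
  apply: eq_eseriesr => k _.
  rewrite (eq_integral (cst (Psi w k))); last first.
    by move=> v; rewrite inE => -[Av /= ->]; exact: aPsi.
  rewrite integral_cst.
    rewrite [RHS]muleAC -[RHS]muleA; congr (_ * _)%E; exact: markov_atom.
  apply: measurableI => //.
  by rewrite -[X in measurable X]setTI; exact: measurable_funPT.
rewrite (eq_integral (cst (\sum_(k <oo) Psi w k * (Q (M J w) k)%:E)%E)); last first.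
  move=> v; rewrite inE => Av; apply: eq_eseriesr => k _.
  by rewrite Av//; congr (_ * _)%E; exact: aPsi.
rewrite integral_cst//; apply: nneseriesZr; last exact: fin_num_measure.
by move=> k; rewrite mule_ge0// lee_fin.
Qed.

(** For the indicator of a forbidden transition, every term of the series in [markov_integral] has
    either the factor [Q = 0] or the indicator 0. *)
Lemma markov_trans_ae : (forall i k, 0 <= Q i k) ->
  {ae P, forall w, forall n, Q (M n w) (M n.+1 w) != 0}.
Proof.
move=> Q0; apply: ae_foralln => n.
have aQ : adapted n.+1 (fun w => Q (M n w) (M n.+1 w) == 0).
  by move=> w w' ww'; rewrite !ww'.
pose A := [set w | Q (M n w) (M n.+1 w) == 0].
have mA : measurable A.
  have := @adapted_measurable _ bool n.+1 _ aQ measurableT [set true] I.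
  by rewrite setTI.
exists A; split=> //; last by move=> w /= /negP; rewrite negbK.
rewrite -[A]setIT -integral_indic//.
pose Psi w k : \bar R := ((Q (M n w) k == 0)%:R)%:E.
transitivity (\int[P]_w Psi w (M n.+1 w))%E.
  by apply: eq_integral => w _; rewrite indicE mem_setE.
rewrite markov_integral//.
- apply: integral0_eq => w _; rewrite eseries0// => k _ _.
  by rewrite /Psi; case: eqP => [->|]; rewrite ?mule0 ?mul0e.
- by move=> w k; rewrite lee_fin ler0n.
- by move=> k w w' ww'; rewrite /Psi ww'.
Qed.

End markov_property.

Section nonneg_series.
Context (R : realType).
Implicit Type u : nat -> R.

Lemma cvg_series_EFin u (l : R) : (forall k, 0 <= u k) ->
  series u @ \oo --> l -> (\sum_(k <oo) (u k)%:E = l%:E)%E.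
Proof.
move=> u0 ul; apply/cvg_lim => //.
rewrite (_ : (fun n => _) = EFin \o series u); last first.
  by apply/funext => n /=; rewrite sumEFin.
by apply: cvg_EFin => //; exact: nearW.
Qed.

Lemma EFin_cvg_series u (l : R) : (forall k, 0 <= u k) ->
  (\sum_(k <oo) (u k)%:E = l%:E)%E -> series u @ \oo --> l.
Proof.
move=> u0 ul; have cu : cvgn (series u).
  by apply: nnseries_is_cvg => //; rewrite ul ltry.
have := cvg_series_EFin u0 cu; rewrite ul => -[->]; exact: cu.
Qed.

End nonneg_series.

(** * Sums over the zeros of the chain and their second moments *)

Section renewal_chain.
Context d (T : measurableType d) (R : realType) (P : probability T R).
Variables (p : nat -> R) (q : nat -> R) (M : nat -> {RV P >-> nat}).
Hypotheses (hp : prob_mass p) (hM : markov_chain q (renewal_trans p) M).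

Lemma prob_mass_ge0 k : 0 <= p k. Proof. by have [] := hp. Qed.
Hint Resolve prob_mass_ge0 : core.

Lemma series_prob_mass : series p @ \oo --> (1 : R).
Proof. by apply: EFin_cvg_series => //; have [_ ->] := hp. Qed.

Lemma renewal_trans_ge0 i j : 0 <= renewal_trans p i j.
Proof. by case: i => [|i] //=. Qed.
Hint Resolve renewal_trans_ge0 : core.

Lemma renewal_trans_sum i (f : nat -> \bar R) : (forall k, 0 <= f k)%E ->
  (\sum_(k <oo) (f k * (renewal_trans p i k)%:E) =
   if i is i'.+1 then f i' else \sum_(k <oo) (f k * (p k)%:E))%E.
Proof.
move=> f0; case: i => [//|i] /=.
rewrite (@nneseriesD1 _ _ i xpredT)//; last by move=> k _; rewrite mule_ge0// lee_fin.
rewrite eqxx mule1 [X in (_ + X)%E]eseries0 ?adde0// => k _ /andP[_ /negPf ->].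
by rewrite mule0.
Qed.

Lemma renewal_integral J (Psi : T -> nat -> \bar R) :
  (forall w k, 0 <= Psi w k)%E -> (forall k, adapted M J (Psi^~ k)) ->
  (\int[P]_w Psi w (M J.+1 w) =
   \int[P]_w (if M J w is i.+1 then Psi w i
              else \sum_(k <oo) (Psi w k * (p k)%:E)))%E.
Proof.
move=> Psi0 aPsi; rewrite (markov_integral hM)//.
by apply: eq_integral => w _; rewrite renewal_trans_sum.
Qed.

Definition renewal_term (a : nat -> T -> bool) (g : nat -> R) i w : R :=
  if a i w && (M i w == 0%N) then g (M i.+1 w) else 0.

Definition renewal_sum (a : nat -> T -> bool) (g : nat -> R) (N : nat) (w : T) : R :=
  \sum_(i < N) renewal_term a g i w.

Lemma adapted_renewal_term a g i : adapted M i (a i) ->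
  adapted M i.+1 (renewal_term a g i).
Proof.
move=> ai w w' ww'; rewrite /renewal_term !ww'//.
by rewrite (ai w w')// => j ji; rewrite ww'//; exact: leqW.
Qed.

Lemma adapted_renewal_sum a g N : (forall i, adapted M i (a i)) ->
  adapted M N (renewal_sum a g N).
Proof.
move=> aa w w' ww'; apply: eq_bigr => i _.
apply: (@adapted_renewal_term a g i (aa i) w w') => j ji; rewrite ww'//.
by have := ltn_ord i; lia.
Qed.

Lemma renewal_term_integral a h (H : R) i : adapted M i (a i) ->
  (forall k, 0 <= h k) -> (\sum_(k <oo) (h k * p k)%:E = H%:E)%E ->
  (\int[P]_w (renewal_term a h i w)%:E =
   \int[P]_w (if a i w && (M i w == 0%N) then H else 0)%:E)%E.
Proof.
move=> ai h0 hH.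
pose Psi w k : \bar R := (if a i w && (M i w == 0%N) then h k else 0)%:E.
rewrite (@renewal_integral i Psi).
- apply: eq_integral => w _; rewrite /Psi; case: (M i w) => [|j].
    case: (a i w) => /=; last by rewrite eseries0// => k _ _; rewrite mul0e.
    by rewrite -hH; apply: eq_eseriesr => k _; rewrite EFinM.
  by rewrite andbF.
- by move=> w k; rewrite /Psi lee_fin; case: ifP.
- by move=> k w w' ww'; rewrite /Psi (ai w w')// ww'.
Qed.

(** Orthogonality of martingale increments: given the path up to [N], the new term has mean 0, so
    its product with the past sum drops out and only the mean of its square is added. *)
Lemma renewal_sum_sqr a g (G : R) N : (forall i, adapted M i (a i)) ->
  series (fun k => g k * p k) @ \oo --> (0 : R) ->
  series (fun k => g k ^+ 2 * p k) @ \oo --> (G : R) ->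
  (\int[P]_w (renewal_sum a g N w ^+ 2)%:E =
   \sum_(i < N) \int[P]_w (renewal_term a (fun k => g k ^+ 2)%R i w)%:E)%E.
Proof.
move=> aa g0 gG.
have G2 : (\sum_(k <oo) (g k ^+ 2 * p k)%:E = G%:E)%E.
  by apply: cvg_series_EFin => // k; rewrite mulr_ge0// sqr_ge0.
have G0 : 0 <= G.
  by rewrite -lee_fin -G2 nneseries_ge0// => k _ _; rewrite lee_fin mulr_ge0// sqr_ge0.
elim: N => [|N IH].
  rewrite big_ord0 integral0_eq// => w _.
  by rewrite /renewal_sum big_ord0 expr0n.
rewrite big_ord_recr/= -IH (@renewal_term_integral _ _ G)//; last first.
  by move=> k; exact: sqr_ge0.
pose W := renewal_sum a g N.
have aW : adapted M N W by exact: adapted_renewal_sum.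
(* The square after one more step, with the past sum frozen and the next state [k] free. *)
pose Psi w k : \bar R :=
  ((W w + (if a N w && (M N w == 0%N) then g k else 0)) ^+ 2)%:E.
transitivity (\int[P]_w Psi w (M N.+1 w))%E.
  by apply: eq_integral => w _; rewrite /renewal_sum big_ord_recr.
rewrite (@renewal_integral N Psi); last 2 first.
- by move=> w k; rewrite lee_fin sqr_ge0.
- by move=> k w w' ww'; rewrite /Psi (aW w w')// (aa N w w')// ww'.
rewrite -ge0_integralD//; last 4 first.
- by move=> w _; rewrite lee_fin sqr_ge0.
- apply: (@adapted_measurable _ _ _ _ M _ _ N) => w w' ww'.
  by rewrite -/W (aW w w').
- by move=> w _; rewrite lee_fin; case: ifP.
- apply: (@adapted_measurable _ _ _ _ M _ _ N) => w w' ww'.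
  by rewrite (aa N w w')// ww'.
apply: eq_integral => w _; rewrite /Psi -/W.
case: (M N w) => [|j]; last by rewrite andbF/= addr0 adde0.
move: (W w) => W'.
case: (a N w) => /=.
  rewrite -EFinD; under eq_eseriesr do rewrite -EFinM.
  apply: cvg_series_EFin; first by move=> k; rewrite mulr_ge0// sqr_ge0.
  (* The zero summand is the limit of the cross term; the target then matches the three series of
     the expanded square. *)
  have -> : W' ^+ 2 + G = W' ^+ 2 *: 1 + (2 * W') *: 0 + G.
    by rewrite scaler0 addr0 [_ *: 1]mulr1.
  rewrite (_ : series _ = (W' ^+ 2 *: series p +
     (2 * W') *: series (fun k => g k * p k)) +
     series (fun k => g k ^+ 2 * p k)).
    apply: cvgD => //; apply: cvgD; apply: cvgZr => //.
    exact: series_prob_mass.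
  apply/funext => n; rewrite /series/= !fctE /series/= /GRing.scale/= !mulr_sumr -!big_split/=.
  apply: eq_bigr => k _; ring.
rewrite adde0; under eq_eseriesr do rewrite addr0.
rewrite (@nneseriesZl _ _ xpredT); last by move=> k _; rewrite lee_fin.
by have [_ ->] := hp; rewrite mule1.
Qed.

End renewal_chain.

(** * Strong law along powers of two *)

Section ae_convergence.
Context d (T : measurableType d) (R : realType) (P : probability T R).

(** Borel-Cantelli in integral form: the sum of the [Y m] has finite mean, hence is finite almost
    everywhere, and its tails, which dominate the terms, tend to 0. *)
Lemma ae_cvg0_geometric (Y : nat -> T -> \bar R) (C r : R) :
  (forall m, measurable_fun setT (Y m)) -> (forall m w, 0 <= Y m w)%E ->
  0 <= C -> 0 <= r < 1 ->
  (forall m, \int[P]_w Y m w <= (C * r ^+ m)%:E)%E ->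
  {ae P, forall w, Y m w @[m --> \oo] --> (0 : \bar R)%E}.
Proof.
move=> mY Y0 C0 /andP[r0 r1] YC.
pose S w : \bar R := (\sum_(m <oo) Y m w)%E.
have S0 w : (0 <= S w)%E by exact: nneseries_ge0.
have mS : measurable_fun setT S by exact: ge0_emeasurable_sum.
have iS : P.-integrable setT S.
  apply/integrableP; split=> //.
  under eq_integral do rewrite gee0_abs//.
  rewrite integral_nneseries//.
  apply: (@le_lt_trans _ _ (\sum_(m <oo) (C * r ^+ m)%:E)%E).
    by apply: lee_nneseries => // m _ _; exact: integral_ge0.
  rewrite (@cvg_series_EFin _ _ (C * (1 - r)^-1)) ?ltry//.
    by move=> k; rewrite mulr_ge0// exprn_ge0.
  by apply: (@cvg_geometric_series R C r); rewrite ger0_norm.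
have := integrable_ae measurableT iS; apply: filterS => w /(_ I) Sw.
have Soo : (S w < +oo)%E by rewrite ltey_eq Sw.
apply: (@squeeze_cvge _ _ _ _ (fun=> 0%E) _ (fun m => (\sum_(m <= k <oo) Y k w)%E)).
- apply: nearW => m; rewrite Y0/=.
  rewrite (@nneseries_split _ _ m 1)// addn1 big_nat1 leeDl//.
  exact: nneseries_ge0.
- exact: cvg_cst.
- exact: (@nneseries_tail_cvg _ (fun k => Y k w) xpredT).
Qed.

End ae_convergence.

Section strong_law.
Context d (T : measurableType d) (R : realType) (P : probability T R).
Variables (p : nat -> R) (q : nat -> R) (M : nat -> {RV P >-> nat}) (C : R).
Hypotheses (hp : prob_mass p) (hM : markov_chain q (renewal_trans p) M).
Hypothesis hC : (\sum_(k <oo) (k.+1%:R ^+ 2 * p k)%:E = C%:E)%E.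

Let p0 k : 0 <= p k. Proof. by have [] := hp. Qed.

Definition mean (f : nat -> R) : R := limn (series (fun k => f k * p k)).

Lemma is_cvg_mean (f : nat -> R) (c : R) :
  (forall k, `|f k| <= c * k.+1%:R ^+ 2) ->
  cvgn (series (fun k => f k * p k)).
Proof.
move=> fc; apply: normed_cvg.
apply: (@series_le_cvg _ _ (fun k => c * (k.+1%:R ^+ 2 * p k))) => [n|n|n|].
- exact: normr_ge0.
- by rewrite mulrA mulr_ge0// (le_trans _ (fc n)).
- by rewrite /= normrM (ger0_norm (p0 n)) mulrA ler_wpM2r.
  have : series (fun k => k.+1%:R ^+ 2 * p k) @ \oo --> C.
    by apply: EFin_cvg_series => // k; rewrite mulr_ge0// sqr_ge0.
  by move=> /cvgP/(@is_cvg_seriesZ _ _ c).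
Qed.

(** The mean square of the normalised sum at [2 ^ m] is at most [G / 2 ^ m], which is geometric
    because the times are powers of two. Linear growth of [f] makes its variance [G] finite. *)
Lemma strong_law_dyadic (f : nat -> R) : (forall k, `|f k| <= k.+1%:R) ->
  {ae P, forall w,
    renewal_sum M (fun _ _ => true) (fun k => f k - mean f) (2 ^ m) w / 2 ^+ m
      @[m --> \oo] --> (0 : R)}.
Proof.
move=> fk; pose mu := mean f; pose g k := f k - mu.
have fk2 k : `|f k| <= 1 * k.+1%:R ^+ 2.
  by rewrite mul1r (le_trans (fk k))// -natrX ler_nat; nia.
have cf : series (fun k => f k * p k) @ \oo --> mu := is_cvg_mean fk2.
have g0 : series (fun k => g k * p k) @ \oo --> (0 : R).
  rewrite (_ : series _ = series (fun k => f k * p k) - mu *: series p).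
    rewrite -[X in _ --> X](subrr mu); apply: cvgB => //.
    rewrite -[X in _ --> X]mulr1; apply: cvgZr; exact: series_prob_mass.
  apply/funext => n; rewrite /series/= !fctE/= [_ *: _]mulr_sumr -sumrB.
  by apply: eq_bigr => k _; rewrite /g; ring.
(* [|f k - mu| <= (k + 1) + |mu| <= (1 + |mu|) (k + 1)]. *)
have gk k : `|g k ^+ 2| <= (1 + `|mu|) ^+ 2 * k.+1%:R ^+ 2.
  rewrite normrX -exprMn; apply: lerXn2r; rewrite ?nnegrE ?mulr_ge0 ?addr_ge0//.
  rewrite (le_trans (ler_normB _ _))// mulrDl mul1r lerD//.
  by rewrite ler_peMr// ler1n.
have cg := is_cvg_mean gk.
set G := limn _ in cg.
have aT i : adapted M i ((fun _ _ => true) i : T -> bool) by [].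
have Gsum : (\sum_(k <oo) (g k ^+ 2 * p k)%:E = G%:E)%E.
  by apply: cvg_series_EFin => // k; rewrite mulr_ge0// sqr_ge0.
have G0 : 0 <= G.
  by rewrite -lee_fin -Gsum nneseries_ge0// => k _ _; rewrite lee_fin mulr_ge0// sqr_ge0.
pose W m w := renewal_sum M (fun _ _ => true) g (2 ^ m) w.
have aW m : adapted M (2 ^ m) (W m) by exact: adapted_renewal_sum.
have Y0 : {ae P, forall w, ((W m w / 2 ^+ m) ^+ 2)%:E @[m --> \oo] --> (0 : \bar R)%E}.
  apply: (@ae_cvg0_geometric _ _ _ _ (fun m w => ((W m w / 2 ^+ m) ^+ 2)%:E) G (2^-1)) => //.
  - move=> m; apply: (@adapted_measurable _ _ _ _ M _ _ (2 ^ m)) => w w' ww'.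
    by rewrite (aW m w w').
  - by move=> m w; rewrite lee_fin sqr_ge0.
  - by apply/andP; split; lra.
  move=> m; under eq_integral do rewrite exprMn mulrC EFinM.
  rewrite ge0_integralZl//; last 2 first.
  - apply: (@adapted_measurable _ _ _ _ M _ _ (2 ^ m)) => w w' ww'.
    by rewrite (aW m w w').
  - by move=> w _; rewrite lee_fin sqr_ge0.
  rewrite (renewal_sum_sqr hp hM (2 ^ m) aT g0 cg).
  apply: (@le_trans _ _ (((2 ^- m) ^+ 2)%:E * \sum_(i < 2 ^ m) G%:E)%E).
    apply: lee_wpmul2l; first by rewrite lee_fin sqr_ge0.
    apply: lee_sum => i _; rewrite (@renewal_term_integral _ _ _ _ _ _ _ hp hM _ _ G)//; last first.
      by move=> k; exact: sqr_ge0.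
    apply: (@le_trans _ _ (\int[P]_w (cst G%:E) w)%E); last first.
      by rewrite integral_cst// [X in (_ * X)%E]probability_setT mule1.
    apply: ge0_le_integral => //.
    + by move=> w _; rewrite lee_fin; case: ifP.
    + apply: (@adapted_measurable _ _ _ _ M _ _ i) => w w' ww'.
      by rewrite ww'.
    + by move=> w _; rewrite /= lee_fin; case: ifP.
  rewrite sumEFin -EFinM lee_fin sumr_const card_ord -[G *+ _]mulr_natr natrX.
  rewrite !exprVn; have : (2 ^+ m : R) != 0 by rewrite gt_eqF// exprn_gt0.
  by move: (2 ^+ m) => u u0; rewrite le_eqVlt; apply/orP; left; apply/eqP; field.
move: Y0; apply: filterS => w; rewrite -/(EFin \o _) => /fine_cvgP[_ h].
apply/cvgr0Pnorm_lt => e e0.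
have e2 : 0 < e ^+ 2 by rewrite exprn_gt0.
move/cvgr0Pnorm_lt : h => /(_ _ e2); apply: filterS => m /=.
by rewrite normrX ltr_pXn2r ?nnegrE// ltW.
Qed.

End strong_law.

(** * Mean sampling error *)

Section tail.
Context (R : realType) (p : nat -> R).
Hypothesis hp : prob_mass p.

Let p0 k : 0 <= p k. Proof. by have [] := hp. Qed.

Lemma tail_sumE s : (\sum_(s <= k <oo) (p k)%:E = (tail_sum p s)%:E)%E.
Proof.
rewrite /tail_sum fineK// ge0_fin_numE; last first.
  by apply: nneseries_ge0 => k _ _; rewrite lee_fin.
apply: (@le_lt_trans _ _ 1%E); last exact: ltry.
have [_ <-] := hp; rewrite (@nneseries_split _ _ 0 s); last first.
  by move=> k _; rewrite lee_fin.
rewrite add0n leeDr// sumEFin lee_fin.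
exact: sumr_ge0.
Qed.

Lemma tail_sum_indicator s :
  (\sum_(k <oo) ((s <= k)%N%:R * p k)%:E = (tail_sum p s)%:E)%E.
Proof.
rewrite -tail_sumE (@nneseries_split _ _ 0 s); last first.
  by move=> k _; rewrite lee_fin mulr_ge0.
rewrite add0n.
rewrite big_nat big1 ?add0e => [|k /andP[_ ks]].
  rewrite [RHS]eseries_cond [LHS]eseries_cond; apply: eq_eseriesr => k.
  by move=> /= ->; rewrite mul1r.
by rewrite leqNgt ks mul0r.
Qed.

Lemma tail_sum_ge0 s : 0 <= tail_sum p s.
Proof. by rewrite -lee_fin -tail_sumE nneseries_ge0// => k _ _; rewrite lee_fin. Qed.

Lemma le_tail_sum s k : (s <= k)%N -> p k <= tail_sum p s.
Proof.
move=> sk; rewrite -lee_fin -tail_sum_indicator.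
rewrite (@nneseriesD1 _ _ k xpredT)//; last by move=> i _; rewrite lee_fin mulr_ge0.
rewrite sk mul1r leeDl// nneseries_ge0// => i _ _.
by rewrite lee_fin mulr_ge0.
Qed.

(** The law of the remaining run at age [s]; identically 0 when the tail vanishes, since division by
    0 gives 0. *)
Definition cond_law (s l : nat) : R := p (l + s)%N / tail_sum p s.

Lemma cond_law_ge0 s l : 0 <= cond_law s l.
Proof. by rewrite divr_ge0// tail_sum_ge0. Qed.

(** Survives a vanishing tail, because the tail dominates [p (l + s)]. *)
Lemma cond_lawM s l : cond_law s l * tail_sum p s = p (l + s)%N.
Proof.
rewrite /cond_law; have [t0|t0] := eqVneq (tail_sum p s) 0; last by rewrite divfK.
rewrite t0 mulr0; apply/esym/eqP; rewrite eq_le p0 -t0 le_tail_sum//.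
exact: leq_addl.
Qed.

Lemma cond_law_le1 s l : cond_law s l <= 1.
Proof.
have := tail_sum_ge0 s; rewrite le_eqVlt => /predU1P[t0|t0].
  by rewrite /cond_law -t0 invr0 mulr0.
by rewrite ler_pdivrMr// mul1r le_tail_sum// leq_addl.
Qed.

Lemma nneseries_single k (f : nat -> R) : (forall i, 0 <= f i) ->
  (\sum_(i <oo) ((i == k)%:R * f i)%:E = (f k)%:E)%E.
Proof.
move=> f0; rewrite (@nneseriesD1 _ _ k xpredT)//; last first.
  by move=> i _; rewrite lee_fin mulr_ge0.
rewrite eqxx mul1r eseries0 ?adde0// => i _ /andP[_ /negPf ->].
by rewrite mul0r.
Qed.

Lemma nneseries_addn_le (u : nat -> \bar R) s : (forall k, 0 <= u k)%E ->
  (\sum_(l <oo) u (l + s)%N <= \sum_(k <oo) u k)%E.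
Proof.
move=> u0; rewrite nneseries_addn//.
rewrite [leRHS](@nneseries_split _ _ 0 s)//; rewrite add0n leeDr//.
exact: sume_ge0.
Qed.

End tail.

Section estimation_error.
Context d (T : measurableType d) (R : realType) (P : probability T R).
Variables (p : nat -> R) (q : nat -> R) (M : nat -> {RV P >-> nat}) (C : R).
Hypotheses (hp : prob_mass p) (hM : markov_chain q (renewal_trans p) M).
Hypothesis hC : (\sum_(k <oo) (k.+1%:R ^+ 2 * p k)%:E = C%:E)%E.

Let p0 k : 0 <= p k. Proof. by have [] := hp. Qed.

Definition visit (s i : nat) (w : T) : bool := (M i w == 0%N) && (s <= M i.+1 w)%N.

(* A zero at [i] followed by at least [s] ones makes [i + s] a position of age
   [s]; it is sampled if it is among the first [n] such positions after [m] and
   age [s] has already occurred up to time [m]. *)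
Definition sampled (s m n i : nat) (w : T) : bool :=
  [&& (m < i + s)%N,
      has (fun j => (j + s <= m)%N && visit s j w) (iota 0 i)
    & (count (fun j => (m < j + s)%N && visit s j w) (iota 0 i) < n)%N].

(** Its mean under [p] is [p (l + s) - cond_law p s l * tail_sum p s = 0]. It vanishes for [k < s],
    so zeros whose run does not reach age [s] contribute nothing. *)
Definition centered (s l k : nat) : R :=
  (k == l + s)%N%:R - cond_law p s l * (s <= k)%N%:R.

(** At an admissible time, this will be [n] times the error of the estimated frequency of [l]
    ([phat_deviation]). *)
Definition deviation (m n s l N : nat) (w : T) : R :=
  renewal_sum M (sampled s m n) (centered s l) N w.

(** Only visits at [j < i] enter, and they read the chain up to [j.+1 <= i]: the selection is made
    before the run at [i] is revealed, although the sampled position is [i + s]. *)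
Lemma adapted_sampled s m n i : adapted M i (sampled s m n i).
Proof.
move=> w w' ww'; rewrite /sampled.
have E j : j \in iota 0 i -> visit s j w = visit s j w'.
  by rewrite mem_iota => ji; rewrite /visit !ww'; lia.
congr [&& _, _ & _].
  by apply: eq_in_has => j ji; rewrite E.
by congr (_ < _)%N; apply: eq_in_count => j ji; rewrite E.
Qed.
Hint Resolve adapted_sampled : core.

Lemma measurable_renewal_term s m n h i :
  measurable_fun setT (fun w => (renewal_term M (sampled s m n) h i w)%:E : \bar R).
Proof.
apply: (@adapted_measurable _ _ _ _ M _ _ i.+1) => w w' ww'.
by rewrite (@adapted_renewal_term _ _ _ _ _ (sampled s m n) h i _ w w').
Qed.

(** At most [n] visits are sampled, and none unless age [s] occurred up to [m]. That event is
    bounded by the number of zeros up to [m] with run at least [s], whose mean is controlled by the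
    tail of [p] at [s]. *)
Lemma sampled_visits_le s m n N w :
  renewal_sum M (sampled s m n) (fun k => (s <= k)%N%:R) N w <=
  n%:R * \sum_(i < m.+1) renewal_term M (fun _ _ => true) (fun k => (s <= k)%N%:R) i w.
Proof.
pose c N := count (fun j => (m < j + s)%N && visit s j w) (iota 0 N).
pose B N := has (fun j => (j + s <= m)%N && visit s j w) (iota 0 N).
(* A sampled visit raises the capped counter, and can occur only once [B] has become true. *)
have h1 : renewal_sum M (sampled s m n) (fun k => (s <= k)%N%:R) N w <=
    (minn n (c N) * B N)%:R.
  rewrite /renewal_sum; elim: N => [|N IH]; first by rewrite big_ord0.
  rewrite big_ord_recr/=.
  have cS : c N.+1 = (c N + ((m < N + s)%N && visit s N w))%N.
    by rewrite /c -[N.+1]addn1 iotaD count_cat/= addn0.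
  have BS : B N.+1 = B N || ((N + s <= m)%N && visit s N w).
    by rewrite /B -[N.+1]addn1 iotaD has_cat/= orbF.
  apply: (le_trans (lerD IH (lexx _))).
  rewrite /renewal_term /sampled -/(c N) -/(B N) cS BS.
  move: (c N) (B N) => cN BN; rewrite /visit.
  case: (M N w == 0%N); rewrite ?andbT ?andbF /= ?addr0 ?addn0 ?orbF//.
  case: (s <= M N.+1 w)%N; rewrite ?andbT ?andbF /= ?if_same ?addr0 ?addn0 ?orbF//.
  case: ifP => [/and3P[-> -> cn]|_] /=; rewrite -?natrD ?addr0 ler_nat; last first.
    by apply: leq_mul; [lia|case: BN].
  lia.
apply: (le_trans h1); rewrite natrM ler_pM// ?ler_nat ?geq_minl//.
case: (boolP (B N)) => [/hasP[j _ /andP[jm vj]]|_]; last first.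
  by rewrite sumr_ge0// => i _; rewrite /renewal_term; case: ifP.
have jm1 : (j < m.+1)%N by lia.
rewrite (bigD1 (Ordinal jm1))//= {1}/renewal_term/=.
move/andP: vj => [-> ->]; rewrite lerDl sumr_ge0// => i _.
by rewrite /renewal_term; case: ifP.
Qed.

Lemma sampled_count_le s m n N w :
  renewal_sum M (sampled s m n) (fun k => (s <= k)%N%:R) N w <= n%:R.
Proof.
pose c N := count (fun j => (m < j + s)%N && visit s j w) (iota 0 N).
suff h : renewal_sum M (sampled s m n) (fun k => (s <= k)%N%:R) N w <= (minn n (c N))%:R.
  by apply: (le_trans h); rewrite ler_nat geq_minl.
rewrite /renewal_sum; elim: N => [|N IH]; first by rewrite big_ord0.
rewrite big_ord_recr/=.
have cS : c N.+1 = (c N + ((m < N + s)%N && visit s N w))%N.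
  by rewrite /c -[N.+1]addn1 iotaD count_cat/= addn0.
apply: (le_trans (lerD IH (lexx _))).
rewrite /renewal_term /sampled -/(c N) cS.
move: (c N) => cN; rewrite /visit.
case: (M N w == 0%N); rewrite ?andbT ?andbF /= ?addr0 ?addn0//.
case: (s <= M N.+1 w)%N; rewrite ?andbT ?andbF /= ?if_same ?addr0 ?addn0//.
case: ifP => [/and3P[-> _ cn]|_] /=; rewrite -?natrD ?addr0 ler_nat; lia.
Qed.

Lemma measurable_renewal_sum s m n h N :
  measurable_fun setT (fun w => (renewal_sum M (sampled s m n) h N w)%:E : \bar R).
Proof.
apply: (@adapted_measurable _ _ _ _ M _ _ N) => w w' ww'.
by rewrite (@adapted_renewal_sum _ _ _ _ _ (sampled s m n) h N _ w w').
Qed.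

Lemma measurable_deviation m n s l N :
  measurable_fun setT (fun w => `|deviation m n s l N w|%:E).
Proof.
apply: (@adapted_measurable _ _ _ _ M _ _ N) => w w' ww'.
by rewrite /deviation (@adapted_renewal_sum _ _ _ _ _ (sampled s m n) _ N _ w w').
Qed.

Lemma renewal_term_ge0 (a : nat -> T -> bool) h i w : (forall k, 0 <= h k) ->
  0 <= renewal_term M a h i w.
Proof. by move=> h0; rewrite /renewal_term; case: ifP. Qed.

Lemma renewal_sum_integral s m n h N : (forall k, 0 <= h k) ->
  (\int[P]_w (renewal_sum M (sampled s m n) h N w)%:E =
   \sum_(i < N) \int[P]_w (renewal_term M (sampled s m n) h i w)%:E)%E.
Proof.
move=> h0; rewrite -(@ge0_integral_sum _ _ _ P setT _ 'I_N
    (fun i w => (renewal_term M (sampled s m n) h i w)%:E))//.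
- by apply: eq_integral => w _; rewrite sumEFin.
- by move=> i; exact: measurable_renewal_term.
- by move=> i w _; rewrite lee_fin renewal_term_ge0.
Qed.

(** [centered s l k ^+ 2] is at most the indicator of [s <= k], so the sum of the mean squares is at
    most the mean number of sampled visits. *)
Lemma integral_deviation_sqr m n s l N :
  (\int[P]_w (deviation m n s l N w ^+ 2)%:E <= (n%:R)%:E)%E.
Proof.
have cl0 := cond_law_ge0 hp s l; have cl1 := cond_law_le1 hp s l.
have gle k : centered s l k ^+ 2 <= (s <= k)%N%:R.
  rewrite /centered; case: (leqP s k) => sk; last first.
    by rewrite mulr0 subr0 (_ : k == _ = false) ?expr0n//; lia.
  rewrite mulr1; case: (k == _) => /=; nra.
have gC (f : nat -> R) : (forall k, `|f k| <= 1) -> cvgn (series (fun k => f k * p k)).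
  move=> f1; apply: (@is_cvg_mean _ _ C hp hC f 1) => k.
  by rewrite mul1r (le_trans (f1 k))// exprn_ege1// ler1n.
have g1 k : `|centered s l k| <= 1.
  rewrite /centered ler_norml; case: (k == _); case: (s <= k)%N => /=; lra.
have gsq1 k : `|centered s l k ^+ 2| <= 1 by rewrite normrX expr_le1.
have g0 : series (fun k => centered s l k * p k) @ \oo --> (0 : R).
  rewrite (_ : series _ = series (fun k => (k == l + s)%N%:R * p k) -
      cond_law p s l *: series (fun k => (s <= k)%N%:R * p k)).
    rewrite -[X in _ --> X](subrr (p (l + s)%N)); apply: cvgB => //.
      apply: EFin_cvg_series => [k|]; first by rewrite mulr_ge0.
      exact: nneseries_single.
    rewrite -(cond_lawM hp); apply: cvgZr.
    apply: EFin_cvg_series => [k|]; first by rewrite mulr_ge0.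
    exact: tail_sum_indicator.
  apply/funext => N'; rewrite /series/= !fctE/= [_ *: _]mulr_sumr -sumrB.
  by apply: eq_bigr => k _; rewrite /centered; ring.
rewrite /deviation (renewal_sum_sqr hp hM N _ g0 (gC _ gsq1))//.
apply: (@le_trans _ _ (\int[P]_w (renewal_sum M (sampled s m n) (fun k => (s <= k)%N%:R) N w)%:E)%E).
  rewrite renewal_sum_integral//; apply: lee_sum => i _.
  apply: ge0_le_integral => //.
  - by move=> w _; rewrite lee_fin renewal_term_ge0// => k; exact: sqr_ge0.
  - exact: measurable_renewal_term.
  - exact: measurable_renewal_term.
  - by move=> w _; rewrite lee_fin /renewal_term; case: ifP.
apply: (@le_trans _ _ (\int[P]_w (cst (n%:R)%:E) w)%E); last first.
  by rewrite integral_cst// [X in (_ * X)%E]probability_setT mule1.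
apply: ge0_le_integral => //.
- by move=> w _; rewrite lee_fin sumr_ge0// => i _; exact: renewal_term_ge0.
- exact: measurable_renewal_sum.
- by move=> w _; rewrite /= lee_fin; exact: sampled_count_le.
Qed.

(** With [r = sqrt n], integrate [|D| <= D^2 / (2 r) + r / 2]; since [D^2] has mean at most [r^2],
    each half is at most [r / 2]. *)
Lemma integral_deviation_le_sqrt m n s l N : (0 < n)%N ->
  (\int[P]_w `|deviation m n s l N w|%:E <= (Num.sqrt n%:R)%:E)%E.
Proof.
move=> n0; set r : R := Num.sqrt n%:R.
have r0 : 0 < r by rewrite sqrtr_gt0 ltr0n.
have r2 : r ^+ 2 = n%:R by rewrite sqr_sqrtr.
have mD2 : measurable_fun setT (fun w => (deviation m n s l N w ^+ 2)%:E).
  apply: (@adapted_measurable _ _ _ _ M _ _ N) => w w' ww'.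
  by rewrite /deviation (@adapted_renewal_sum _ _ _ _ _ (sampled s m n) _ N _ w w').
apply: (@le_trans _ _ (\int[P]_w
   (((2 * r)^-1)%:E * (deviation m n s l N w ^+ 2)%:E + (r / 2)%:E))%E).
  apply: ge0_le_integral => //.
  - exact: measurable_deviation.
  - apply: emeasurable_funD => //; exact: measurable_funeM.
  - (* AM-GM *)
    move=> w _; rewrite -EFinM -EFinD lee_fin -(real_normK (num_real (deviation _ _ _ _ _ _))).
    move: `|_| => y; rewrite -subr_ge0.
    rewrite (_ : _ - _ = (y - r) ^+ 2 / (2 * r)).
      by rewrite divr_ge0 ?sqr_ge0// mulr_ge0// ltW.
    by field; exact: lt0r_neq0.
rewrite ge0_integralD//; last 3 first.
- by move=> w _; rewrite -EFinM lee_fin mulr_ge0// ?invr_ge0 ?sqr_ge0// mulr_ge0// ltW.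
- exact: measurable_funeM.
- by move=> w _; rewrite lee_fin divr_ge0// ltW.
rewrite ge0_integralZl//; last 2 first.
- by move=> w _; rewrite lee_fin sqr_ge0.
- by rewrite lee_fin invr_ge0 mulr_ge0// ltW.
rewrite integral_cst// [X in (_ + _ * X)%E]probability_setT mule1.
apply: (@le_trans _ _ (((2 * r)^-1)%:E * (n%:R)%:E + (r / 2)%:E)%E).
  apply: leeD => //; apply: lee_wpmul2l; last exact: integral_deviation_sqr.
  by rewrite lee_fin invr_ge0 mulr_ge0// ltW.
rewrite -EFinM -EFinD lee_fin -r2 le_eqVlt; apply/orP; left; apply/eqP; field.
exact: lt0r_neq0.
Qed.

(** Meant for large [l], where a bound by [sqrt n] could not be summed. The absolute value is at
    most a sum of two nonnegative parts of equal [p]-mean [p (l + s)], and the second is a multiple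
    of the indicator of [s <= k], to which [sampled_visits_le] applies. *)
Lemma integral_deviation_le_mass m n s l N :
  (\int[P]_w `|deviation m n s l N w|%:E <=
   (2 * n%:R * m.+1%:R * p (l + s)%N)%:E)%E.
Proof.
pose c := cond_law p s l; have cl0 : 0 <= c := cond_law_ge0 hp s l.
pose h k : R := (k == l + s)%N%:R + c * (s <= k)%N%:R.
have h0 k : 0 <= h k by rewrite addr_ge0// mulr_ge0.
pose v k : R := (s <= k)%N%:R.
have v0 k : 0 <= v k by [].
have h20 k : 0 <= 2 * c * v k by rewrite mulr_ge0// mulr_ge0.
apply: (@le_trans _ _ (\int[P]_w (renewal_sum M (sampled s m n) h N w)%:E)%E).
  apply: ge0_le_integral => //.
  - exact: measurable_deviation.
  - exact: measurable_renewal_sum.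
  - move=> w _; rewrite lee_fin /deviation /renewal_sum.
    rewrite (le_trans (ler_norm_sum _ _ _))//; apply: ler_sum => i _.
    rewrite /renewal_term; case: ifP => _; last by rewrite normr0.
    rewrite /centered /h (le_trans (ler_normB _ _))// !ger0_norm//.
    by rewrite mulr_ge0.
have vmean a i : adapted M i (a i) -> (\int[P]_w (renewal_term M a v i w)%:E =
    \int[P]_w (if a i w && (M i w == 0%N) then tail_sum p s else 0)%:E)%E.
  move=> aa; apply: (renewal_term_integral hp hM) => //.
  exact: (tail_sum_indicator hp).
(* At a selected zero only the [p]-mean matters, so [h] may be replaced by twice its second part. *)
have hv i : (\int[P]_w (renewal_term M (sampled s m n) h i w)%:E =
    \int[P]_w (renewal_term M (sampled s m n) (fun k => 2 * c * v k)%R i w)%:E)%E.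
  have cp : ((p (l + s)%N)%:E = \sum_(k <oo) (c * v k * p k)%:E)%E.
    rewrite -(cond_lawM hp) EFinM -(tail_sum_indicator hp).
    rewrite -(@nneseriesZl _ _ xpredT); last by move=> k _; rewrite lee_fin mulr_ge0.
    by apply: eq_eseriesr => k _; rewrite -EFinM mulrA.
  have e1 : (\sum_(k <oo) (h k * p k)%:E = (2 * p (l + s)%N)%:E)%E.
    rewrite mulr_natl mulr2n EFinD -{1}(nneseries_single (l + s)%N p0) cp.
    rewrite -nneseriesD.
    - by apply: eq_eseriesr => k _; rewrite -EFinD /h mulrDl.
    - by move=> k _; rewrite lee_fin mulr_ge0.
    - by move=> k _; rewrite lee_fin mulr_ge0// mulr_ge0.
  have e2 : (\sum_(k <oo) (2 * c * v k * p k)%:E = (2 * p (l + s)%N)%:E)%E.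
    rewrite EFinM cp -(@nneseriesZl _ _ xpredT); last first.
      by move=> k _; rewrite lee_fin mulr_ge0// mulr_ge0.
    by apply: eq_eseriesr => k _; rewrite -EFinM !mulrA.
  rewrite (renewal_term_integral hp hM (@adapted_sampled s m n i) h0 e1).
  by rewrite (renewal_term_integral hp hM (@adapted_sampled s m n i) h20 e2).
rewrite renewal_sum_integral//; under eq_bigr do rewrite hv.
rewrite -renewal_sum_integral//.
pose V w : R := \sum_(i < m.+1) renewal_term M (fun _ _ => true) v i w.
have mV : measurable_fun setT (fun w => (V w)%:E).
  apply: (@adapted_measurable _ _ _ _ M _ _ m.+1) => w w' ww'.
  by have := @adapted_renewal_sum _ _ _ _ M (fun _ _ => true) v m.+1 (fun _ _ _ _ => erefl) w w' ww'; rewrite /V /renewal_sum => ->.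
have V0 w : (0 <= (V w)%:E)%E.
  by rewrite lee_fin sumr_ge0// => i _; exact: renewal_term_ge0.
apply: (@le_trans _ _ (\int[P]_w ((2 * c * n%:R)%:E * (V w)%:E))%E).
  apply: ge0_le_integral => //.
  - move=> w _; rewrite lee_fin sumr_ge0// => i _; apply: renewal_term_ge0 => k.
    exact: h20.
  - exact: measurable_renewal_sum.
  - exact: measurable_funeM.
  - move=> w _; rewrite -EFinM lee_fin -[2 * c * _ * _]mulrA.
    rewrite (_ : renewal_sum _ _ _ _ _ = 2 * c * renewal_sum M (sampled s m n) v N w).
      apply: ler_wpM2l; [exact: mulr_ge0|exact: sampled_visits_le].
    rewrite /renewal_sum mulr_sumr; apply: eq_bigr => i _.
    by rewrite /renewal_term; case: ifP; rewrite ?mulr0.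
rewrite ge0_integralZl//; last by rewrite lee_fin mulr_ge0// mulr_ge0.
apply: (@le_trans _ _ ((2 * c * n%:R)%:E * (m.+1%:R * tail_sum p s)%:E)%E).
  apply: lee_wpmul2l; first by rewrite lee_fin mulr_ge0// mulr_ge0.
  rewrite /V; under eq_integral do rewrite -sumEFin.
  rewrite ge0_integral_sum//; last 2 first.
  - move=> i; apply: (@adapted_measurable _ _ _ _ M _ _ i.+1) => w w' ww'.
    by rewrite /renewal_term !ww'.
  - by move=> i w _; rewrite lee_fin renewal_term_ge0.
  apply: (@le_trans _ _ (\sum_(i < m.+1) (tail_sum p s)%:E)%E); last first.
    by rewrite sumEFin lee_fin sumr_const card_ord mulr_natl.
  apply: lee_sum => i _; rewrite vmean//.
  apply: (@le_trans _ _ (\int[P]_w (cst (tail_sum p s)%:E) w)%E); last first.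
    by rewrite integral_cst// [X in (_ * X)%E]probability_setT mule1.
  apply: ge0_le_integral => //.
  + by move=> w _; rewrite lee_fin; case: ifP; rewrite ?tail_sum_ge0.
  + apply: (@adapted_measurable _ _ _ _ M _ _ i) => w w' ww'.
    by rewrite ww'.
  + by move=> w _; rewrite /= lee_fin; case: ifP; rewrite ?tail_sum_ge0.
rewrite -EFinM lee_fin -(cond_lawM hp) -/c le_eqVlt; apply/orP; left; apply/eqP; ring.
Qed.

End estimation_error.

Section sample_error.
Context d (T : measurableType d) (R : realType) (P : probability T R).
Variables (p : nat -> R) (q : nat -> R) (M : nat -> {RV P >-> nat}) (C : R).
Hypotheses (hp : prob_mass p) (hM : markov_chain q (renewal_trans p) M).
Hypothesis hC : (\sum_(k <oo) (k.+1%:R ^+ 2 * p k)%:E = C%:E)%E.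

Let p0 k : 0 <= p k. Proof. by have [] := hp. Qed.

Let C0 : 0 <= C.
Proof.
rewrite -lee_fin -hC nneseries_ge0// => k _ _.
by rewrite lee_fin mulr_ge0// sqr_ge0.
Qed.

(** The age at the stopping time is random but at most [m], hence the sum over all such ages. The
    weight [l + 1] dominates both 1 and [l], and [2 ^ m.+1] exceeds every [t] with
    [flog R t = m]. *)
Definition sample_error (m n : nat) (w : T) : \bar R :=
  (\sum_(s < m.+1) \sum_(l <oo)
     (l.+1%:R / n%:R * `|deviation p M m n s l (2 ^ m.+1) w|)%:E)%E.

Lemma measurable_sample_error m n : measurable_fun setT (sample_error m n).
Proof.
apply: emeasurable_sum => s; apply: ge0_emeasurable_sum => [k w _ _|k _].
  by rewrite lee_fin mulr_ge0.
under eq_fun do rewrite EFinM.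
apply: measurable_funeM; exact: measurable_deviation.
Qed.

Lemma sample_error_ge0 m n w : (0 <= sample_error m n w)%E.
Proof.
apply: sume_ge0 => s _; apply: nneseries_ge0 => l _ _.
by rewrite lee_fin mulr_ge0.
Qed.

(* The indices [l < L] are controlled in quadratic mean, the others by their
   expected number. *)
Lemma integral_sample_error m n L : (0 < n)%N -> (0 < L)%N ->
  (\int[P]_w sample_error m n w <=
   (m.+1%:R * (L%:R ^+ 2 / Num.sqrt n%:R + 2 * m.+1%:R * C / L%:R))%:E)%E.
Proof.
move=> n0 L0; set r : R := Num.sqrt n%:R.
have r0 : 0 < r by rewrite sqrtr_gt0 ltr0n.
have r2 : n%:R = r * r by rewrite -expr2 sqr_sqrtr.
have L0' : 0 < L%:R :> R by rewrite ltr0n.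
pose t s l w : \bar R :=
  (l.+1%:R / n%:R * `|deviation p M m n s l (2 ^ m.+1) w|)%:E.
have t0 s l w : (0 <= t s l w)%E by rewrite lee_fin mulr_ge0.
have mt s l : measurable_fun setT (t s l).
  rewrite /t; under eq_fun do rewrite EFinM.
  apply: measurable_funeM; exact: measurable_deviation.
rewrite /sample_error ge0_integral_sum//; last 2 first.
- by move=> s; apply: ge0_emeasurable_sum => [k w _ _|k _]; [exact: t0|exact: mt].
- by move=> s w _; apply: nneseries_ge0 => l _ _; exact: t0.
apply: (@le_trans _ _ (\sum_(s < m.+1)
    (L%:R ^+ 2 / r + 2 * m.+1%:R * C / L%:R)%:E)%E); last first.
  by rewrite sumEFin lee_fin sumr_const card_ord [leRHS]mulr_natl.
apply: lee_sum => s _; rewrite (integral_nneseries _ _ (mt s) (fun l w _ => t0 s l w))//.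
(* For [l < L] the term is at most [(l + 1) / sqrt n <= L / sqrt n]. For [l >= L], the inequality
   [(l + 1) L <= (l + s + 1)^2] trades [l + 1] for the second moment divided by [L]. *)
pose b l : R := (l < L)%N%:R * (L%:R / r).
pose e : R := 2 * m.+1%:R / L%:R.
have e0 : 0 <= e by rewrite divr_ge0// ?mulr_ge0// ltW.
pose u k : \bar R := (k.+1%:R ^+ 2 * p k)%:E.
have u0 k : (0 <= u k)%E by rewrite lee_fin mulr_ge0// sqr_ge0.
apply: (@le_trans _ _ (\sum_(l <oo) ((b l)%:E + e%:E * u (l + s)%N))%E).
  apply: lee_nneseries => [l _ _|l _]; first by apply: integral_ge0 => w _; exact: t0.
  rewrite /t; under eq_integral do rewrite EFinM.
  rewrite ge0_integralZl//; last exact: measurable_deviation.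
  rewrite /b; case: ltnP => lL.
    apply: (@le_trans _ _ ((l.+1%:R / n%:R)%:E * r%:E)%E).
      apply: lee_wpmul2l; first by rewrite lee_fin divr_ge0.
      exact: (integral_deviation_le_sqrt hp hM hC).
    apply: (@le_trans _ _ (L%:R / r)%:E).
      rewrite -EFinM lee_fin r2 invfM -!mulrA mulVf ?mulr1 ?gt_eqF//.
      by rewrite ler_pM2r ?invr_gt0// ler_nat.
    by rewrite mul1r leeDl// mule_ge0.
  rewrite mul0r add0e.
  apply: (@le_trans _ _ ((l.+1%:R / n%:R)%:E * (2 * n%:R * m.+1%:R * p (l + s)%N)%:E)%E).
    apply: lee_wpmul2l; first by rewrite lee_fin divr_ge0.
    exact: (integral_deviation_le_mass hp hM).
  rewrite /u -!EFinM lee_fin.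
  have n0' : n%:R != 0 :> R by rewrite pnatr_eq0; lia.
  have lL2 : l.+1%:R * L%:R <= (l + s).+1%:R ^+ 2 :> R.
    by rewrite -natrX -natrM ler_nat; nia.
  apply: (@le_trans _ _ (2 * m.+1%:R * p (l + s)%N * l.+1%:R)).
    rewrite le_eqVlt; apply/orP; left; apply/eqP.
    by move: (l.+1%:R) (m.+1%:R) (n%:R) n0' => x y z z0; field.
  rewrite (_ : e * _ = 2 * m.+1%:R * p (l + s)%N * ((l + s).+1%:R ^+ 2 / L%:R)).
    by rewrite ler_wpM2l ?mulr_ge0// ler_pdivlMr.
  rewrite /e; move: ((l + s).+1%:R) (m.+1%:R) (L%:R) L0' => x y z z0.
  by field; exact: lt0r_neq0.
rewrite nneseriesD; last 2 first.
- by move=> l _; rewrite lee_fin mulr_ge0// divr_ge0// ltW.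
- by move=> l _; rewrite mule_ge0.
rewrite EFinD leeD//.
  rewrite (@nneseries_split _ _ 0 L); last first.
    by move=> l _; rewrite lee_fin mulr_ge0// divr_ge0// ltW.
  rewrite add0n [X in (_ + X)%E]eseries0 => [|l Ll _]; last first.
    by rewrite /b ltnNge Ll mul0r.
  rewrite adde0 sumEFin lee_fin big_nat.
  rewrite (eq_bigr (fun=> L%:R / r)) => [|l]; last first.
    by rewrite /b => /andP[_ ->]; rewrite mul1r.
  by rewrite -big_nat sumr_const_nat subn0 expr2 -mulrA [leRHS]mulr_natl.
rewrite (@nneseriesZl _ _ xpredT)//.
apply: (@le_trans _ _ (e%:E * C%:E)%E).
  by apply: lee_wpmul2l => //; rewrite -hC; exact: (@nneseries_addn_le _ u).
by rewrite -EFinM lee_fin /e le_eqVlt; apply/orP; left; apply/eqP; ring.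
Qed.

(** The right side exceeds [1 + c + ... + c^m], whose terms are at least 1. It serves to absorb
    powers of [m]. *)
Lemma natr_le_geometric (c : R) m : 1 < c -> m.+1%:R <= (1 - c^-1)^-1 * c ^+ m.
Proof.
move=> c1; have c0 : 0 < c by rewrite (lt_trans _ c1).
have d0 : 0 < 1 - c^-1 by rewrite subr_gt0 invf_lt1.
rewrite mulrC ler_pdivlMr//; elim: m => [|m IH].
  by rewrite mul1r expr0 gerBl invr_ge0 ltW.
rewrite -natr1 mulrDl mul1r exprS.
apply: (le_trans (lerD IH (lexx _))).
have cm : 1 <= c ^+ m by rewrite exprn_ege1// ltW.
have cV : c * c^-1 = 1 by rewrite divff// gt_eqF.
move: (c ^+ m) (c^-1) cm cV d0 => x v x1 cV d0.
have : 0 <= (c - 1) * (1 - v) by apply: mulr_ge0; lra.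
have : 0 <= (c - 1) * (x - 1) by apply: mulr_ge0; lra.
nra.
Qed.

Definition sample_size (gamma : R) (m : nat) : nat :=
  `|Num.ceil (2 `^ (m%:R * (1 - gamma)) : R)|%N.

Lemma sample_size_ge gamma m : 2 `^ (m%:R * (1 - gamma)) <= (sample_size gamma m)%:R :> R.
Proof.
rewrite /sample_size natr_absz gtr0_norm ?Num.Theory.ceil_ge//.
by rewrite -(ltr_int R) (lt_le_trans _ (Num.Theory.ceil_ge _))// powR_gt0.
Qed.

Lemma sample_error_cvg0 (gamma : R) : gamma < 1 / 3 ->
  {ae P, forall w, sample_error m (sample_size gamma m) w @[m --> \oo] --> (0 : \bar R)%E}.
Proof.
move=> g13.
(* With [x = c^m = 2^(m/64)]: [n >= x^32] since [1 - gamma >= 1/2], so [sqrt n >= x^16]; [L] is of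
   order [x^4]; and [m + 1 <= K x]. The two parts of the bound are then of order [x^-7] and [x^-2],
   both below [x^-1]. *)
pose c : R := 2 `^ (64^-1).
have c1 : 1 < c.
  have -> : 1 = 1 `^ 64^-1 :> R by rewrite powR1.
  by apply: gt0_ltr_powR; rewrite ?nnegrE//; lra.
have c0 : 0 < c by rewrite (lt_trans _ c1).
have cX k : c ^+ k = 2 `^ (k%:R / 64) by rewrite -(powR_mulrn k (ltW c0)) /c -powRrM mulrC.
pose K : R := (1 - c^-1)^-1.
have K0 : 0 <= K by rewrite invr_ge0 subr_ge0 invf_le1 ?ltW.
apply: (@ae_cvg0_geometric _ _ _ _ (fun m => sample_error m (sample_size gamma m))
   (4 * K + 2 * C * K ^+ 2) c^-1).
- by move=> m; exact: measurable_sample_error.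
- by move=> m w; exact: sample_error_ge0.
- by rewrite addr_ge0 ?mulr_ge0 ?sqr_ge0.
- by rewrite invr_ge0 ltW//= invf_lt1.
move=> m; set n := sample_size gamma m.
have nge : c ^+ (32 * m) <= n%:R.
  rewrite (le_trans _ (sample_size_ge _ _))// cX.
  rewrite ler_powR ?ler1n// natrM.
  have : 0 <= m%:R :> R by [].
  nra.
have n0 : (0 < n)%N.
  by rewrite -(ltr0n R) (lt_le_trans _ nge)// exprn_gt0.
have sn : c ^+ (16 * m) <= Num.sqrt n%:R.
  rewrite -(ger0_norm (exprn_ge0 (16 * m) (ltW c0))) -sqrtr_sqr ler_wsqrtr//.
  by rewrite -exprM (_ : (16 * m * 2 = 32 * m)%N)//; lia.
pose L := (Num.truncn (c ^+ (4 * m))).+1.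
have Lge : c ^+ (4 * m) <= L%:R by rewrite ltW// truncnS_gt.
have Lle : L%:R <= 2 * c ^+ (4 * m).
  have h : 1 <= c ^+ (4 * m) by rewrite exprn_ege1// ltW.
  rewrite /L -natr1 mulr_natl mulr2n lerD//.
  by rewrite truncn_le exprn_ge0// ltW.
apply: (le_trans (@integral_sample_error m n L n0 _)) => //.
have mK : m.+1%:R <= K * c ^+ m by exact: natr_le_geometric.
have x1 : 1 <= c ^+ m by rewrite exprn_ege1// ltW.
rewrite lee_fin [c^-1 ^+ m]exprVn.
move: sn Lge Lle; rewrite !(mulnC _ m) !exprM.
move: (Num.sqrt _) (L%:R) (c ^+ m) (m.+1%:R : R) (ler0n R m.+1) mK x1 => r l x y y0 yK x1 sn Lge Lle.
have x0 : 0 < x by lra.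
have X k : 0 < x ^+ k by rewrite exprn_gt0.
have r0 : 0 < r by exact: lt_le_trans (X 16%N) sn.
have l0 : 0 < l by exact: lt_le_trans (X 4%N) Lge.
have x4 := X 4%N; have x16 := X 16%N.
have l2 : l ^+ 2 <= (2 * x ^+ 4) ^+ 2 by rewrite lerXn2r// nnegrE; lra.
have rV : r^-1 <= (x ^+ 16)^-1 by rewrite lef_pV2.
have lV : l^-1 <= (x ^+ 4)^-1 by rewrite lef_pV2.
have xV1 : x^-1 <= 1 by rewrite invf_le1.
have xV0 : 0 <= x^-1 by rewrite invr_ge0 ltW.
have Kx0 : 0 <= K * x by rewrite mulr_ge0// ltW.
rewrite mulrDr [leRHS]mulrDl; apply: lerD.
  apply: (@le_trans _ _ (K * x * ((2 * x ^+ 4) ^+ 2 / x ^+ 16))).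
    apply: ler_pM => //; first by rewrite divr_ge0 ?sqr_ge0// ltW.
    by apply: ler_pM; rewrite ?sqr_ge0 ?invr_ge0// ltW.
  rewrite (_ : _ * _ = 4 * K * x^-1 * (x ^+ 6)^-1); last by field; exact: lt0r_neq0.
  have x6 := X 6%N.
  by rewrite ler_piMr ?mulr_ge0// invf_le1// exprn_ege1.
rewrite (_ : y * _ = 2 * C * (y * y) / l); last first.
  by field; exact: lt0r_neq0.
apply: (@le_trans _ _ (2 * C * (K * x * (K * x)) / x ^+ 4)).
  apply: ler_pM => //; first by rewrite !mulr_ge0.
    by rewrite invr_ge0 ltW.
  by apply: ler_wpM2l; [rewrite mulr_ge0|exact: ler_pM].
rewrite (_ : _ / _ = 2 * C * K ^+ 2 * x^-1 * x^-1); last by field; exact: lt0r_neq0.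
by rewrite ler_piMr// mulr_ge0// mulr_ge0 ?sqr_ge0// mulr_ge0.
Qed.

End sample_error.

(** * Runs and ages along a path *)

Lemma leastP (A : set nat) t : A t ->
  A (least A) /\ forall s, A s -> (least A <= s)%N.
Proof.
move=> At; have ex : exists n, `[<A n>] by exists t; apply/asboolP.
have : [set t | A t /\ forall s, A s -> (t <= s)%N] (ex_minn ex).
  case: ex_minnP => m /asboolP Am mle; split=> // s As.
  by apply: mle; apply/asboolP.
exact: xgetI.
Qed.

Section renewal_path.
Variables (M : nat -> nat) (x : nat -> bool).
Hypothesis M_step : forall n, (0 < M n)%N -> M n.+1 = (M n).-1.
Hypothesis xE : forall n, x n = (M n != 0)%N.

Lemma path_run n j : (j <= M n)%N -> M (n + j) = (M n - j)%N.
Proof.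
elim: j => [|j IH] jM; first by rewrite addn0 subn0.
have IH' := IH (ltnW jM); rewrite addnS M_step IH'; lia.
Qed.

(** From [i.+1] on the chain counts down and first vanishes at [i.+1 + M i.+1]. *)
Lemma ones_afterE i l : ones_after x i l <-> (l <= M i.+1)%N.
Proof.
split=> [h|h j /andP[ij jl]].
  rewrite leqNgt; apply/negP => lM.
  have := h (i.+1 + M i.+1)%N; rewrite xE path_run// subnn => /(_ _).
  by move=> H; have : false by apply: H; lia.
rewrite xE (_ : j = i.+1 + (j - i.+1))%N; last by lia.
by rewrite path_run; lia.
Qed.

Lemma sigmaE i : sigma x i = M i.+1.
Proof.
rewrite /sigma; set A := mkset _.
have AM : A (M i.+1).
  by split=> [|l /ones_afterE//]; apply/ones_afterE.
have [/ones_afterE h1 h2] := xgetI 0%N AM.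
by apply/eqP; rewrite eqn_leq h1 h2//; apply/ones_afterE.
Qed.

Lemma zero_ge_start i : M i = 0%N -> (M 0 <= i)%N.
Proof.
move=> Mi; rewrite leqNgt; apply/negP => iM.
by have := @path_run 0 i (ltnW iM); rewrite add0n Mi; lia.
Qed.

Lemma psiE : psi x = M 0%N.
Proof.
have h : [set t | x t = false] (M 0%N).
  by rewrite /= xE -[X in M X]add0n path_run// subnn.
have [/= h1 h2] := leastP h; apply/eqP; rewrite eqn_leq h2//=.
by apply: zero_ge_start; apply/eqP; rewrite -[_ == _]negbK -xE; rewrite h1.
Qed.

(** Says that the last zero up to [j] is at [j - s]. Unlike [tau x j == s], it is false before the
    first zero, where [tau] takes its default 0. *)
Definition age_is (s j : nat) : bool :=
  [&& (s <= j)%N, M (j - s) == 0%N & (s <= M (j - s).+1)%N].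

Lemma age_isP s j : age_is s j <->
  [/\ (s <= j)%N, x (j - s)%N = false & forall i, (j - s < i <= j)%N -> x i = true].
Proof.
rewrite /age_is xE; split=> [/and3P[sj /eqP M0 sM]|[sj /negPn M0 h]].
  split=> // [|i ij]; first by rewrite M0.
  by move/ones_afterE : sM; apply; lia.
by rewrite sj M0/=; apply/ones_afterE => i ij; apply: h; lia.
Qed.

Lemma age_is_inj s t j : age_is s j -> age_is t j -> s = t.
Proof.
move=> /age_isP[sj xs hs] /age_isP[tj xt ht].
case: (ltngtP s t) => // st.
  by have := ht (j - s)%N; rewrite xs => H; have : false = true by apply: H; lia.
by have := hs (j - t)%N; rewrite xt => H; have : false = true by apply: H; lia.
Qed.

(** From [j] to [j.+1] the age returns to 0 at a zero and otherwise grows by 1; a run too short for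
    this would make [j.+1] a zero. *)
Lemma age_exists j : (M 0 <= j)%N -> exists s, age_is s j.
Proof.
elim: j => [|j IH] Mj.
  by exists 0%N; rewrite /age_is subn0 leq0n andbT/=; lia.
have [Mj1|Mj1] := eqVneq (M j.+1) 0%N.
  by exists 0%N; rewrite /age_is subn0 Mj1.
have Mj' : (M 0 <= j)%N.
  rewrite leqNgt; apply/negP => jM.
  by have := @path_run 0 j.+1 jM; rewrite add0n; lia.
have [s /and3P[sj Mz sM]] := IH Mj'; exists s.+1.
rewrite /age_is subSS Mz ltnS sj/= ltn_neqAle sM andbT.
apply: contra Mj1 => /eqP sE.
have := @path_run (j - s).+1 s; rewrite -sE => /(_ (leqnn s)).
by rewrite subnn (_ : (j - s).+1 + s = j.+1)%N; [move=> ->|lia].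
Qed.

Lemma tauE s j : (M 0 <= j)%N -> (tau x j == s) = age_is s j.
Proof.
move=> Mj; have [t tj] := age_exists Mj.
have -> : tau x j = t.
  rewrite /tau; set A := mkset _.
  have At : A t by apply/age_isP.
  by have /age_isP := xgetI 0%N At; move=> /age_is_inj; apply.
by apply/eqP/idP => [<-//|sj]; exact: age_is_inj tj sj.
Qed.

Lemma age_is_start s j : age_is s j -> (M 0 <= j)%N.
Proof. by move=> /and3P[_ /eqP/zero_ge_start h _]; lia. Qed.

Lemma age_is_add s i : age_is s (i + s) = (M i == 0%N) && (s <= M i.+1)%N.
Proof. by rewrite /age_is addnK leq_addl. Qed.

Lemma age_is_sigma s j : age_is s j -> sigma x j = (M (j - s).+1 - s)%N.
Proof.
move=> /and3P[sj _ sM]; rewrite sigmaE -path_run//; congr M; lia.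
Qed.

(** Reindexes positions of age [s] by the zeros [i = j - s] that open their runs, since the
    martingale sums run over zeros. Positions below [s] cannot have age [s]. *)
Lemma sum_age_shift (V : nmodType) s N K (F : nat -> V) : (K <= N + s)%N ->
  \sum_(0 <= j < K | age_is s j) F j =
  \sum_(0 <= i < N | [&& (i + s < K)%N, M i == 0%N & (s <= M i.+1)%N]) F (i + s)%N.
Proof.
move=> KN; rewrite (big_nat_widen _ _ _ _ _ KN).
rewrite (@big_cat_nat _ _ _ s)//=; last exact: leq_addl.
rewrite big_nat_cond big1 ?add0r => [|j /andP[/andP[_ js] /andP[/and3P[]]]]; last lia.
rewrite -{1}(add0n s) big_addn addnK; apply: eq_bigl => i.
by rewrite age_is_add andbC.
Qed.

End renewal_path.

(** * Comparing integers with the binary logarithm *)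

Section binary_logarithm.
Context (R : realType).

Let ln2_gt0 : 0 < ln 2 :> R. Proof. by apply: ln_gt0; lra. Qed.

Let mul_ln2 k : k%:R * ln 2 = ln (2 ^ k)%N%:R :> R.
Proof. by rewrite natrX lnXn ?mulr_natl//; lra. Qed.

Lemma log2_le t k : (0 < t)%N -> (@log2 R t%:R <= k%:R) = (t <= 2 ^ k)%N.
Proof.
move=> t0; rewrite /log2 ler_pdivrMr// mul_ln2 ler_ln ?posrE ?ltr0n ?expn_gt0//.
by rewrite ler_nat.
Qed.

Lemma log2_ge t k : (0 < t)%N -> (k%:R <= @log2 R t%:R) = (2 ^ k <= t)%N.
Proof.
move=> t0; rewrite /log2 ler_pdivlMr// mul_ln2 ler_ln ?posrE ?ltr0n ?expn_gt0//.
by rewrite ler_nat.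
Qed.

Lemma log2_gt t k : (0 < t)%N -> (k%:R < @log2 R t%:R) = (2 ^ k < t)%N.
Proof. by move=> t0; rewrite ltNge log2_le// ltnNge. Qed.

Lemma flog_itv t : (0 < t)%N -> (2 ^ flog R t <= t < 2 ^ (flog R t).+1)%N.
Proof.
move=> t0; have l0 : 0 <= @log2 R t%:R by rewrite (log2_ge 0) ?expn0.
have /andP[h1 h2] := truncn_itv l0.
by rewrite -log2_ge// h1/= ltnNge -log2_ge// -ltNge.
Qed.

Lemma flog_ge t m : (2 ^ m <= t)%N -> (m <= flog R t)%N.
Proof.
move=> mt; have t0 : (0 < t)%N by apply: leq_trans mt; rewrite expn_gt0.
have /andP[_ h] := flog_itv t0; have := leq_ltn_trans mt h.
by rewrite ltn_exp2l.
Qed.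

End binary_logarithm.

Lemma index_iota0 K : index_iota 0 K = iota 0 K.
Proof. by rewrite /index_iota subn0. Qed.

Lemma card_ord_pred (Q : pred nat) K : #|[pred j : 'I_K | Q j]| = count Q (iota 0 K).
Proof.
by rewrite -sum1_card -sum1_count -index_iota0 big_mkord.
Qed.

Lemma count_iotaS (Q : pred nat) K : count Q (iota 0 K.+1) = (count Q (iota 0 K) + Q K)%N.
Proof. by rewrite -[K.+1]addn1 iotaD count_cat/= addn0. Qed.

Lemma leq_count_iota (Q : pred nat) K L : (K <= L)%N ->
  (count Q (iota 0 K) <= count Q (iota 0 L))%N.
Proof. by move=> KL; rewrite -(subnKC KL) iotaD count_cat leq_addr. Qed.

(** One more position raises the count by at most 1, so no value is skipped. *)
Lemma count_iota_attained (Q : pred nat) n L : (n <= count Q (iota 0 L))%N ->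
  exists2 K, (K <= L)%N & count Q (iota 0 K) = n.
Proof.
elim: L => [|L IH]; first by rewrite leqn0 => /eqP ->; exists 0%N.
have [/IH[K KL <-] _|nL] := leqP n (count Q (iota 0 L)).
  by exists K => //; exact: leqW.
by rewrite count_iotaS => nL1; exists L.+1 => //; rewrite count_iotaS; lia.
Qed.

(** * The estimators at an admissible time *)

Section estimators.
Context d (T : measurableType d) (R : realType) (P : probability T R).
Variables (p : nat -> R) (M : nat -> {RV P >-> nat}) (gamma : R) (x : nat -> bool) (w : T).
Hypothesis M_step : forall n, (0 < M n w)%N -> M n.+1 w = (M n w).-1.
Hypothesis xE : forall n, x n = (M n w != 0)%N.

Let N n := M n w.
Let hN : forall n, (0 < N n)%N -> N n.+1 = (N n).-1 := M_step.

Lemma ceil_quota t : Num.ceil (quota gamma t) = (sample_size gamma (flog R t))%:Z.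
Proof.
rewrite /sample_size gez0_abs// ltW// -(ltr_int R).
by rewrite (lt_le_trans _ (Num.Theory.ceil_ge _))// powR_gt0.
Qed.

Lemma sample_size_gt0 m : (0 < sample_size gamma m)%N.
Proof. by rewrite -(ltr0n R) (lt_le_trans _ (sample_size_ge _ _))// powR_gt0. Qed.

Variable t : nat.
Hypotheses (t_adm : admissible gamma x t) (t_start : (M 0%N w <= flog R t)%N).

Let m := flog R t.
Let s := tau x t.
Let n := sample_size gamma m.
Let K := kappa_star gamma x t.
Let Q j := (m < j)%N && age_is N s j.

Let t_gt0 : (0 < t)%N.
Proof.
have [[i [_ i0 _]] _] := t_adm; case: posnP i0 => // ->.
(* [ln 0 = 0] by default, so [log2 0 = 0] and no index lies strictly below it. *)
by rewrite /log2 ln0// mul0r ltNge ler0n.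
Qed.

Let t_itv : (2 ^ m <= t < 2 ^ m.+1)%N := flog_itv R t_gt0.

Let QE j : (m < j)%N && (tau x j == s) = Q j.
Proof.
rewrite /Q; case: ltnP => //= mj; rewrite (tauE hN xE)// /N.
by rewrite (leq_trans t_start)// ltnW.
Qed.

(** [2 ^ i < t < 2 ^ m.+1] gives [i <= m]: this is the early occurrence of age [s] that [sampled]
    asks for. *)
Let witness : exists2 i, (i <= m)%N & age_is N s i.
Proof.
have [[i [pi it /eqP si]] _] := t_adm; move: it; rewrite log2_gt// => it.
exists i; first by rewrite -ltnS -(ltn_exp2l _ _ (ltnSn 1)); move: t_itv; lia.
by rewrite -(tauE hN xE)//; move: pi; rewrite (psiE hN xE); exact: ltnW.
Qed.

Lemma age_le_flog : (s <= m)%N.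
Proof. by have [i im /and3P[si _ _]] := witness; exact: leq_trans im. Qed.

Let enough : (n <= count Q (iota 0 t.+1))%N.
Proof.
have [_] := t_adm; rewrite (@card_ord_pred (fun j => (log2 t%:R <= j%:R :> R) && (tau x j == s))).
rewrite -/m => h.
have {h} : (n <= count (fun j => (log2 t%:R <= j%:R :> R) && (tau x j == s)) (iota 0 (2 ^ m)))%N.
  by rewrite -lez_nat -ceil_quota ceil_le_int.
move=> /leq_trans; apply.
have Qt : Q t by rewrite -QE eqxx andbT; have := ltn_expl m (ltnSn 1); move: t_itv; lia.
(* If [t = 2 ^ m], then [log t = m] and admissibility also counts [j = m], which [Q] excludes; the
   position [t] itself makes up for it. Otherwise [log t > m]. *)
have [tE|tE] := eqVneq t (2 ^ m)%N.
  rewrite count_iotaS Qt -tE.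
  apply: (@leq_trans (count (predU Q (pred1 m)) (iota 0 t))).
    apply: sub_count => j /andP[]; rewrite log2_le// tE leq_exp2l// => mj js /=.
    by rewrite -QE js andbT; lia.
  apply: (@leq_trans (count Q (iota 0 t) + count (pred1 m) (iota 0 t))).
    by rewrite -count_predUI leq_addr.
  by rewrite leq_add2l count_uniq_mem ?iota_uniq// leq_b1.
apply: (@leq_trans (count Q (iota 0 (2 ^ m)))); last by apply: leq_count_iota; move: t_itv; lia.
apply: sub_count => j /andP[]; rewrite log2_le// -QE => tj ->; rewrite andbT.
by rewrite -(ltn_exp2l _ _ (ltnSn 1)); move: t_itv; lia.
Qed.

(** Admissibility provides [n] matches by time [t], so [kappa_star] is a true minimum rather than
    the default of [least]. *)
Lemma kappa_starP : (K <= t)%N /\ count Q (iota 0 K.+1) = n.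
Proof.
have n0 : (0 < n)%N by exact: sample_size_gt0.
have [[|k] kt kn] := count_iota_attained enough; first by move: n0; rewrite -kn.
pose A := [set K : nat |
    (#|[pred j : 'I_K.+1 | (m < j)%N && (tau x j == s)]|%:Z = Num.ceil (quota gamma t))%R].
have cE k' : #|[pred j : 'I_k'.+1 | (m < j)%N && (tau x j == s)]| = count Q (iota 0 k'.+1).
  by rewrite (@card_ord_pred (fun j => (m < j)%N && (tau x j == s))); apply: eq_count => j; exact: QE.
have Ak : A k by rewrite /A/= cE kn ceil_quota.
have [AK Kk] := leastP Ak; split; first exact: (leq_trans (Kk _ Ak)).
apply/eqP; rewrite -eqz_nat -cE -ceil_quota; apply/eqP; exact: AK.
Qed.

Let count_shift i : count (fun j => (m < j + s)%N && visit M s j w) (iota 0 i) =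
  count Q (iota 0 (i + s)).
Proof.
rewrite -!sum1_count.
rewrite -!index_iota0 [RHS]big_mkcondl (@sum_age_shift N _ s i _ _ (leqnn _)) [LHS]big_mkcondl.
rewrite [LHS]big_nat_cond [RHS]big_nat_cond; apply: eq_bigl => j.
by rewrite /visit /N ltn_add2r; case: (j < i)%N; rewrite ?andbT ?andbF.
Qed.

(** As [i + s] has age [s], once it lies beyond [m] fewer than [n] matches precede it exactly when
    it is among the [n] matches up to [K]. *)
Let sampledE i : visit M s i w ->
  sampled M s m n i w = (m < i + s)%N && (i + s < K.+1)%N.
Proof.
move=> vi; rewrite /sampled; case: ltnP => //= mi.
have -> /= : has (fun j => (j + s <= m)%N && visit M s j w) (iota 0 i).
  have [j jm /and3P[sj Mj sM]] := witness; apply/hasP; exists (j - s)%N.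
    by rewrite mem_iota; lia.
  by rewrite subnK// jm /visit Mj.
rewrite count_shift; have [_ Kn] := kappa_starP; apply/idP/idP.
  by rewrite -Kn; apply: contraTT; rewrite -!leqNgt; exact: leq_count_iota.
rewrite ltnS => iK; rewrite -Kn.
have Qi : Q (i + s) by rewrite /Q mi age_is_add; exact: vi.
by apply: leq_trans (leq_count_iota Q (_ : (i + s).+1 <= _)%N); rewrite ?count_iotaS ?Qi ?addn1.
Qed.

(** Passes from positions, over which the estimators sum, to zeros; [K <= t < 2 ^ m.+1] makes the
    horizon long enough. *)
Lemma sum_sampled (G : nat -> R) :
  \sum_(m.+1 <= j < K.+1) (tau x j == s)%:R * G (sigma x j) =
  \sum_(i < 2 ^ m.+1) if sampled M s m n i w && (M i w == 0%N) then
     (s <= M i.+1 w)%N%:R * G (M i.+1 w - s)%N else 0.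
Proof.
have [Kt Kn] := kappa_starP.
transitivity (\sum_(0 <= j < K.+1 | age_is N s j) (m < j)%N%:R * G (sigma x j)).
  rewrite (@big_nat_widenl _ _ _ m.+1 0)//= big_mkcond [RHS]big_mkcond.
  apply: eq_bigr => j _ /=; case: ifP => mj; last by rewrite mul0r if_same.
  by have := QE j; rewrite /Q mj /= => ->; case: ifP => _; rewrite ?mul0r.
rewrite (@sum_age_shift N _ _ (2 ^ m.+1)); last by move: t_itv; lia.
rewrite big_mkord big_mkcond; apply: eq_bigr => i _.
have [vi|] := boolP (visit M s i w); last first.
  rewrite /visit /N => /nandP[/negPf ->|/negPf ->]; first by rewrite !andbF.
  by rewrite !andbF mul0r if_same.
rewrite sampledE//; move/andP: (vi) => [Mi sM]; rewrite /N Mi sM !andbT mul1r.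
rewrite (age_is_sigma hN xE (_ : age_is N s _)); last by rewrite age_is_add; exact: vi.
rewrite addnK /N; case: (i + s < _)%N; rewrite ?andbT ?andbF//.
by case: (m < _)%N; rewrite ?mul1r ?mul0r.
Qed.

Lemma sum_matches : \sum_(m.+1 <= j < K.+1) (tau x j == s)%:R = n%:R :> R.
Proof.
have [_ <-] := kappa_starP; rewrite -sum1_count natr_sum -index_iota0.
rewrite (@big_nat_widenl _ _ _ m.+1 0)//= big_mkcond [RHS]big_mkcond.
apply: eq_bigr => j _ /=; rewrite -QE.
by case: ifP => //= _; case: (_ == _).
Qed.

(** Exactly [n] positions match, so [cond_law p s l] is its own average over them and can be
    subtracted term by term. *)
Lemma phat_deviation l :
  phat_star gamma x t l - cond_law p s l = deviation p M m n s l (2 ^ m.+1) w / n%:R.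
Proof.
have n0 : n%:R != 0 :> R by rewrite pnatr_eq0 -lt0n sample_size_gt0.
rewrite /phat_star ceil_quota -/m -/n -/K -/s.
rewrite (_ : (n%:Z)%:~R = n%:R)//.
rewrite -[X in _ - X](mulKf n0) -mulrBr [RHS]mulrC; congr (_ * _).
rewrite -sum_matches mulr_suml -sumrB.
transitivity (\sum_(m.+1 <= j < K.+1) (tau x j == s)%:R *
    ((sigma x j == l)%:R - cond_law p s l)).
  by apply: eq_bigr => j _; rewrite mulrBr -natrM mulnb.
rewrite (sum_sampled (fun k => (k == l)%:R - cond_law p s l)).
apply: eq_bigr => i _; rewrite /renewal_term; case: ifP => // _.
rewrite /centered; case: leqP => sM /=.
  by rewrite mul1r mulr1 -(eqn_add2r s) subnK.
by rewrite mul0r mulr0 subr0 (_ : _ == _ = false)//; lia.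
Qed.

Lemma phat_sample_error :
  (\sum_(l <oo) (l.+1%:R * `|phat_star gamma x t l - cond_law p s l|)%:E <=
   sample_error p M m n w)%E.
Proof.
rewrite /sample_error (bigD1 (Ordinal (age_le_flog : (s < m.+1)%N)))//=.
rewrite (_ : (\sum_(l <oo) _)%E = (\sum_(l <oo)
    (l.+1%:R / n%:R * `|deviation p M m n s l (2 ^ m.+1) w|)%:E)%E).
  rewrite leeDl// sume_ge0// => i _; apply: nneseries_ge0 => l _ _.
  by rewrite lee_fin mulr_ge0.
apply: eq_eseriesr => l _; rewrite phat_deviation normrM normfV.
by rewrite (ger0_norm (ler0n R n)) mulrA mulrAC.
Qed.

End estimators.

(** * Density of the admissible times *)

Lemma sum_ltn_le n k : (\sum_(0 <= j < n) (j < k) <= k)%N.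
Proof.
rewrite (eq_bigr (fun j => if (j < k)%N then 1 else 0)%N) => [|j _]; last by case: ltnP.
rewrite -big_mkcond/= sum1_count index_iota0 -size_filter.
rewrite -[leqRHS](size_iota 0); apply: uniq_leq_size; first exact/filter_uniq/iota_uniq.
by move=> j; rewrite mem_filter !mem_iota => /andP[].
Qed.

Section path_counts.
Variables (N : nat -> nat) (x : nat -> bool).
Hypothesis N_step : forall n, (0 < N n)%N -> N n.+1 = (N n).-1.
Hypothesis xE : forall n, x n = (N n != 0)%N.

(* A zero at [i] opens a cycle of [N i.+1 + 1] positions; the cycles tile the
   half-line, up to the residual run [N n]. *)
Lemma cycle_lengths n :
  (\sum_(i < n) (if N i == 0 then (N i.+1).+1 else 0) + N 0 = n + N n)%N.
Proof.
elim: n => [|n IH]; first by rewrite big_ord0.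
rewrite big_ord_recr/= addnAC IH; case: eqP => Nn; first by rewrite Nn; lia.
by rewrite N_step; lia.
Qed.

Lemma sum_nat_between S b n :
  (\sum_(S.+1 <= s < n | s <= b) 1 <= b - S)%N.
Proof.
have [nb|bn] := leqP n b.+1.
  apply: (@leq_trans (\sum_(S.+1 <= s < n) 1)).
    by rewrite big_mkcond; apply: leq_sum => s _; case: ifP.
  by rewrite sum_nat_const_nat muln1; lia.
rewrite (eq_bigl (fun s => true && (s < b.+1)%N))//.
by rewrite -(big_nat_widen _ _ _ _ _ (ltnW bn)) sum_nat_const_nat muln1; lia.
Qed.

(** The run opened at a zero [i] has at most [N i.+1 - S] positions of age above [S]: write the left
    side as a sum over ages [s > S], reindex by opening zeros and exchange the sums. *)
Lemma long_ages S n :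
  (\sum_(0 <= j < n) ((N 0 <= j) && (S < tau x j)) <=
   \sum_(i < n) (if N i == 0 then N i.+1 - S else 0))%N.
Proof.
apply: (@leq_trans (\sum_(0 <= j < n) \sum_(S.+1 <= s < n | age_is N s j) 1)).
  rewrite big_nat_cond [leqRHS]big_nat_cond; apply: leq_sum => j /andP[/andP[_ jn] _].
  case: (leqP (N 0) j) => //= Nj; case: (ltnP S (tau x j)) => //= St.
  have := tauE N_step xE (tau x j) Nj; rewrite eqxx => /esym aj.
  have tj : (tau x j <= j)%N by have /and3P[] := aj.
  rewrite big_mkcond/= (bigD1_seq (tau x j)) ?iota_uniq ?mem_index_iota ?St/=//.
    by rewrite aj leq_addr.
  exact: leq_ltn_trans tj jn.
rewrite (exchange_big_dep_nat xpredT)//=.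
under eq_bigr do rewrite (@sum_age_shift N _ _ n n)// ?leq_addr//.
rewrite (exchange_big_dep_nat xpredT)//= big_mkord.
apply: leq_sum => i _; case: eqP => Ni /=; last first.
  by rewrite big_mkcond big1// => s _; rewrite andbF.
apply: leq_trans (sum_nat_between S (N i.+1) n).
rewrite big_mkcond [leqRHS]big_mkcond; apply: leq_sum => s _.
by case: (i + s < n)%N; case: (s <= _)%N.
Qed.

(** The visit at [i] reaches age [s] at [i + s]; at most [s] of these positions fall at or beyond
    [n], and at most [k] below [k]. *)
Lemma visits_shift s n k :
  (\sum_(i < n) ((N i == 0) && (s <= N i.+1)) <=
   count (fun j => (k <= j) && age_is N s j) (iota 0 n) + s + k)%N.
Proof.
have -> : (\sum_(i < n) ((N i == 0) && (s <= N i.+1)) =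
    \sum_(0 <= j < n + s | age_is N s j) 1)%N.
  rewrite (@sum_age_shift N _ s n (n + s))// big_mkord [RHS]big_mkcond.
  by apply: eq_bigr => i _; rewrite ltn_add2r ltn_ord/=; case: (_ && _).
rewrite big_mkcond/= (@big_cat_nat _ _ _ n)//= ?leq_addr//.
apply: (@leq_trans (\sum_(0 <= j < n) (((k <= j) && age_is N s j) + (j < k)) + s)).
  apply: leq_add.
    by apply: leq_sum => j _; case: (leqP k j); case: (age_is _ _ _).
  apply: (@leq_trans (\sum_(n <= j < n + s) 1)); first by apply: leq_sum => j _; case: ifP.
  by rewrite sum_nat_const_nat muln1; lia.
rewrite big_split/= [leqRHS]addnAC leq_add2r; apply: leq_add.
  by rewrite -sum1_count -index_iota0 [leqRHS]big_mkcond; apply: leq_sum => j _; case: (_ && _).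
exact: sum_ltn_le.
Qed.

End path_counts.

Section density.
Context (R : realType) (p : nat -> R) (C gamma : R) (N : nat -> nat) (x : nat -> bool).
Hypotheses (hp : prob_mass p).
Hypothesis hC : (\sum_(k <oo) (k.+1%:R ^+ 2 * p k)%:E = C%:E)%E.
Hypothesis gamma_gt0 : 0 < gamma.
Hypothesis N_step : forall n, (0 < N n)%N -> N n.+1 = (N n).-1.
Hypothesis N_run : forall n, N n = 0%N -> p (N n.+1) != 0.
Hypothesis xE : forall n, x n = (N n != 0)%N.

Let p0 k : 0 <= p k. Proof. by have [] := hp. Qed.

Definition fluctuation (f : nat -> R) (n : nat) : R :=
  \sum_(i < n) if N i == 0%N then f (N i.+1) - mean p f else 0.

Hypothesis lln_visit : forall s,
  fluctuation (fun k => (s <= k)%N%:R) (2 ^ m) / 2 ^+ m @[m --> \oo] --> (0 : R).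
(** For [j = 0] the summands are cycle lengths; for [j = S.+1] truncated subtraction leaves the
    excess of the run over [S]. *)
Hypothesis lln_excess : forall j,
  fluctuation (fun k => (k.+1 - j)%N%:R) (2 ^ m) / 2 ^+ m @[m --> \oo] --> (0 : R).

Let Z n : R := \sum_(i < n) (N i == 0%N)%:R.

Lemma fluctuationE f n :
  \sum_(i < n) (if N i == 0%N then f (N i.+1) else 0) =
  Z n * mean p f + fluctuation f n.
Proof.
rewrite /Z /fluctuation mulr_suml -big_split/=; apply: eq_bigr => i _.
by case: eqP => _; rewrite ?mul0r ?addr0// mul1r addrC subrK.
Qed.

Let Z_le n : Z n <= n%:R.
Proof.
rewrite /Z -natr_sum ler_nat -[leqRHS]subn0 -[leqRHS]muln1 -sum_nat_const_nat big_mkord.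
by apply: leq_sum => i _; case: (_ == _).
Qed.

Lemma meanE f : (forall k, 0 <= f k) -> (forall k, f k <= k.+1%:R ^+ 2) ->
  (\sum_(k <oo) (f k * p k)%:E = (mean p f)%:E)%E.
Proof.
move=> f0 f1; apply: cvg_series_EFin => [k|]; first by rewrite mulr_ge0.
apply: (@is_cvg_mean _ _ C hp hC f 1) => k.
by rewrite mul1r ger0_norm.
Qed.

Let excess_le j k : (k.+1 - j)%N%:R <= k.+1%:R ^+ 2 :> R.
Proof. by rewrite -natrX ler_nat; nia. Qed.

Lemma mean_excess_ge1 : 1 <= mean p (fun k => (k.+1 - 0)%N%:R).
Proof.
rewrite -lee_fin -meanE//; have [_ <-] := hp.
apply: lee_nneseries => k _; rewrite lee_fin//.
by rewrite ler_peMl// ler1n subn0.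
Qed.

(** A Markov inequality: [(j + 1) (k - j) <= (k + 1)^2] pointwise. *)
Lemma mean_excess_le j : mean p (fun k => (k.+1 - j.+1)%N%:R) <= C / j.+1%:R.
Proof.
rewrite ler_pdivlMr ?ltr0n// mulrC -lee_fin EFinM -meanE// -hC.
rewrite -(@nneseriesZl _ _ xpredT); last by move=> k _; rewrite lee_fin mulr_ge0.
apply: lee_nneseries => k _; rewrite -EFinM lee_fin; first by rewrite !mulr_ge0.
by rewrite mulrA ler_wpM2r// -natrM -natrX ler_nat; nia.
Qed.

Lemma mean_visit s : mean p (fun k => (s <= k)%N%:R) = tail_sum p s.
Proof.
apply/EFin_inj; rewrite -meanE//; first exact: tail_sum_indicator.
by move=> k; rewrite -natrX ler_nat; case: (s <= k)%N => /=; nia.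
Qed.

(** The cycles opened before [2 ^ m] cover every position from [N 0] on, so the zeros number
    asymptotically at least [2 ^ m / a], with [a] the mean cycle length. A proportion [tail_sum p s]
    of them opens a run of length at least [s]; [delta] is half the resulting density. *)
Lemma visits_linear s : 0 < tail_sum p s -> exists2 delta : R, 0 < delta &
  \forall m \near \oo, delta * 2 ^+ m <=
    (\sum_(i < 2 ^ m) ((N i == 0%N) && (s <= N i.+1)%N))%:R.
Proof.
move=> ts; set a := mean p (fun k => (k.+1 - 0)%N%:R).
have a1 : 1 <= a := mean_excess_ge1.
have a0 : 0 < a by lra.
exists (tail_sum p s / (2 * a)); first by rewrite divr_gt0// mulr_gt0.
pose W f m : R := fluctuation f (2 ^ m) / 2 ^+ m.
have lim : tail_sum p s * (1 - (N 0%N)%:R * 2^-1 ^+ m -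
      W (fun k => (k.+1 - 0)%N%:R) m) + a * W (fun k => (s <= k)%N%:R) m
    @[m --> \oo] --> tail_sum p s * (1 - (N 0%N)%:R * 0 - 0) + a * 0.
  apply: cvgD; apply: cvgM; try exact: cvg_cst; last exact: lln_visit.
  apply: cvgB; last exact: lln_excess.
  apply: cvgB; first exact: cvg_cst.
  apply: cvgM; first exact: cvg_cst.
  by apply: cvg_expr; rewrite ger0_norm; lra.
rewrite !mulr0 !subr0 mulr1 addr0 in lim.
have t2 : tail_sum p s / 2 < tail_sum p s by lra.
apply: filterS (cvgr_ge _ lim _ t2) => m; rewrite /W.
set W1 := fluctuation _ _; set W2 := fluctuation _ _ => h.
have m0 : 0 < 2 ^+ m :> R by rewrite exprn_gt0.
have V : (\sum_(i < 2 ^ m) ((N i == 0%N) && (s <= N i.+1)%N))%:R =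
    Z (2 ^ m) * tail_sum p s + W2.
  rewrite -mean_visit -fluctuationE natr_sum; apply: eq_bigr => i _.
  by case: eqP.
have L : 2 ^+ m - (N 0%N)%:R <= Z (2 ^ m) * a + W1.
  rewrite -fluctuationE -natrX lerBlDr.
  have := cycle_lengths N_step (2 ^ m).
  move/(congr1 (fun k => k%:R : R)); rewrite !natrD natr_sum => E.
  rewrite (eq_bigr (fun i : 'I_(2 ^ m) => (if N i == 0 then (N i.+1).+1 else 0)%N%:R)).
    by rewrite E lerDl.
  by move=> i _; case: ifP; rewrite ?subn0.
rewrite V.
rewrite mulrAC ler_pdivrMr ?mulr_gt0//.
set t := tail_sum p s in ts h *; set z := Z _ in L *.
have h' : t / 2 * 2 ^+ m <= t * (2 ^+ m - (N 0%N)%:R - W1) + a * W2.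
  rewrite -(ler_pM2r m0) in h; apply: (le_trans h).
  rewrite le_eqVlt; apply/orP; left; apply/eqP; rewrite exprVn.
  by move: (2 ^+ m) m0 => y y0; field; exact: lt0r_neq0.
have : t * (2 ^+ m - (N 0%N)%:R - W1) <= t * (z * a) by rewrite ler_pM2l//; lra.
by move: h'; move: (2 ^+ m) (N 0%N)%:R => y u; lra.
Qed.

Lemma quota_negligible s (delta : R) : 0 < delta ->
  \forall m \near \oo, 2 `^ (m%:R * (1 - gamma)) + (s + m.+1)%:R <= delta * 2 ^+ m.
Proof.
move=> d0; pose r : R := 2 `^ (- gamma).
have r0 : 0 < r by rewrite powR_gt0.
have r1 : r < 1.
  rewrite /r powRN invf_lt1 ?powR_gt0//.
  rewrite -[ltLHS](_ : 1 `^ gamma = 1); last by rewrite powR1.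
  by apply: gt0_ltr_powR; rewrite ?nnegrE//; lra.
(* The terms after division by [2 ^ m]: [r < 1] because [gamma > 0], and the last one comes from
   [m + 1 <= 3 (3/2)^m]. *)
have lim : r ^+ m + s%:R * 2^-1 ^+ m + 3 * (3 / 4) ^+ m @[m --> \oo] -->
    0 + s%:R * 0 + 3 * (0 : R).
  apply: cvgD; first apply: cvgD.
  - by apply: cvg_expr; rewrite ger0_norm ?ltW.
  - by apply: cvgM; [exact: cvg_cst|apply: cvg_expr; rewrite ger0_norm; lra].
  - by apply: cvgM; [exact: cvg_cst|apply: cvg_expr; rewrite ger0_norm; lra].
rewrite !mulr0 !addr0 in lim.
apply: filterS (cvgr_le _ lim _ d0) => m h.
have m0 : 0 < 2 ^+ m :> R by rewrite exprn_gt0.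
have -> : 2 `^ (m%:R * (1 - gamma)) = r ^+ m * 2 ^+ m.
  rewrite /r -!powR_mulrn ?powR_ge0// -powRrM -powRD; last by apply/implyP.
  by congr (_ `^ _); ring.
have hm : m.+1%:R <= 3 * (3 / 2) ^+ m :> R.
  have c1 : 1 < 3 / 2 :> R by lra.
  apply: (le_trans (natr_le_geometric m c1)).
  by rewrite le_eqVlt; apply/orP; left; apply/eqP; congr (_ * _); field.
rewrite -(ler_pM2r m0) in h; apply: le_trans h.
rewrite [leRHS]mulrDl [X in _ <= X + _]mulrDl -addrA lerD2l natrD; apply: lerD.
  by rewrite -mulrA -exprMn mulVf ?expr1n ?mulr1.
apply: (le_trans hm); rewrite -[leRHS]mulrA -exprMn.
by rewrite [X in _ <= _ * X ^+ _](_ : _ = 3 / 2)//; field.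
Qed.

(** Positions of age [s] have positive density and the quota is of lower order, which gives the
    second condition. For the first, one occurrence [i] after the first zero serves every
    [t > 2 ^ i]. *)
Lemma admissible_eventually s : 0 < tail_sum p s -> exists T0, forall t,
  (T0 <= t)%N -> tau x t = s -> admissible gamma x t.
Proof.
move=> /visits_linear[delta d0 vis]; have quo := quota_negligible s d0.
have [m1 _ hm1] : \forall m \near \oo, 2 `^ (m%:R * (1 - gamma)) + (s + m.+1)%:R <=
    (\sum_(i < 2 ^ m) ((N i == 0%N) && (s <= N i.+1)%N))%:R :> R.
  by near=> m; apply: (@le_trans _ _ (delta * 2 ^+ m)); near: m.
have count_ge m k : (m1 <= m)%N -> (k <= m.+1)%N -> 2 `^ (m%:R * (1 - gamma)) <=
    (count (fun j => (k <= j)%N && age_is N s j) (iota 0 (2 ^ m)))%:R :> R.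
  move=> m1m km; have := hm1 m m1m; have := visits_shift N s (2 ^ m) k.
  rewrite -(ler_nat R) => h1 h2; have := le_trans h2 h1.
  rewrite -addnA [(count _ _ + _)%:R]natrD => h3; rewrite -(lerD2r (s + m.+1)%:R) (le_trans h3)// lerD2l.
  by rewrite ler_nat leq_add2l.
pose m2 := maxn m1 (N 0).
(* The count of age [s] beyond [N 0] is positive, so there is an occurrence strictly after the first
   zero. *)
have [i i0 ai] : exists2 i, (N 0 < i)%N & age_is N s i.
  have := count_ge m2 (N 0).+1 (leq_maxl _ _) (leq_maxr _ _).
  move/(lt_le_trans (powR_gt0 _ _)) => /(_ (ltr0Sn _ _)); rewrite ltr0n -has_count.
  by move=> /hasP[i _ /andP[]]; exists i.
exists (maxn (2 ^ i.+1) (2 ^ m1)) => t; rewrite geq_max => /andP[it mt] ts.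
have t0 : (0 < t)%N by apply: leq_trans it; rewrite expn_gt0.
have Ni : (N 0 <= i)%N := ltnW i0.
split.
  exists i; rewrite (psiE N_step xE) log2_gt// ts; split=> //.
    by apply: leq_trans it; rewrite ltn_exp2l.
  by apply/eqP; rewrite (tauE N_step xE).
rewrite (@card_ord_pred (fun j => (@log2 R t%:R <= j%:R) && (tau x j == tau x t))) ts.
apply: (le_trans (count_ge _ (flog R t).+1 (flog_ge R mt) (leqnn _))).
rewrite ler_nat; apply: sub_count => j /andP[mj aj].
rewrite (tauE N_step xE) ?(age_is_start N_step aj)// aj andbT log2_le//.
have /andP[_ /ltnW h] := flog_itv R t0; apply: (leq_trans h).
by rewrite leq_exp2l.
Unshelve. all: by end_near. Qed.

Definition inadmissible_count (n : nat) : nat :=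
  \sum_(0 <= t < n) ~~ `[< admissible gamma x t >].

(** An inadmissible time is either early or has age above [S], and such ages have density at most
    [C / S.+1] up to fluctuations. *)
Lemma inadmissible_density (e : R) : 0 < e ->
  \forall n \near \oo, (inadmissible_count n)%:R <= e * n%:R.
Proof.
move=> e0.
have C0 : 0 <= C.
  rewrite -lee_fin -hC nneseries_ge0// => k _ _.
  by rewrite lee_fin mulr_ge0// sqr_ge0.
(* Ages above [S], their fluctuation and the early times will take [e / 8] each, which stays below
   [e / 2] at powers of two. *)
pose S := Num.truncn (8 * C / e).
have CS : C / S.+1%:R <= e / 8.
  rewrite ler_pdivrMr ?ltr0n//.
  have := truncnS_gt (8 * C / e); rewrite -/S ltr_pdivrMr// => h.
  by move: h; move: (S.+1%:R) => z; lra.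
have [T0 hT0] : exists T0, forall s t, (s <= S)%N -> 0 < tail_sum p s ->
    (T0 <= t)%N -> tau x t = s -> admissible gamma x t.
  elim: (S) => [|S' [T0 IH]].
    have [/admissible_eventually[T0 h]|h] := boolP (0 < tail_sum p 0%N).
      by exists T0 => s t; rewrite leqn0 => /eqP ->; move=> _; exact: h.
    by exists 0%N => s t; rewrite leqn0 => /eqP ->; rewrite (negPf h).
  have [/admissible_eventually[T1 h]|h] := boolP (0 < tail_sum p S'.+1).
    exists (maxn T0 T1) => s t; rewrite geq_max leq_eqVlt => /predU1P[->|sS] ts /andP[t0 t1].
      exact: h.
    exact: IH.
  exists T0 => s t; rewrite leq_eqVlt => /predU1P[->|sS]; last exact: IH.
  by rewrite (negPf h).
pose T1 := maxn T0 (N 0).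
have bad n : (inadmissible_count n <=
    T1 + \sum_(i < n) (if N i == 0 then N i.+1 - S else 0))%N.
  apply: leq_trans (leq_add (leqnn _) (long_ages N_step xE S n)).
  apply: (@leq_trans (\sum_(0 <= j < n) ((j < T1) + ((N 0 <= j) && (S < tau x j))))%N).
    apply: leq_sum => t _; case: (ltnP t T1) => [_|]; first by case: (`[< _ >]).
    rewrite geq_max => /andP[tT0 tN]; rewrite tN/=.
    case: (ltnP S (tau x t)) => [_|tS]; first by case: (`[< _ >]).
    rewrite add0n; case: asboolP => // -[]; apply: (hT0 (tau x t)) => //.
    (* The run around [t] has a length of positive probability by [N_run], so the tail at its age is
       positive. *)
    have /and3P[_ /eqP Nz tl] : age_is N (tau x t) t by rewrite -(tauE N_step xE).
    by rewrite (lt_le_trans _ (le_tail_sum hp tl))// lt_def p0 N_run.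
  rewrite big_split/= leq_add2r.
  exact: sum_ltn_le.
have e8 : 0 < e / 8 by lra.
have lim : T1%:R * 2^-1 ^+ m @[m --> \oo] --> T1%:R * (0 : R).
  by apply: cvgM; [exact: cvg_cst|apply: cvg_expr; rewrite ger0_norm; lra].
rewrite mulr0 in lim.
have [m1 _ dyadic] : \forall m \near \oo, (inadmissible_count (2 ^ m))%:R <= e / 2 * 2 ^+ m.
  near=> m.
  have m0 : 0 < 2 ^+ m :> R by rewrite exprn_gt0.
  have h1 : T1%:R <= e / 8 * 2 ^+ m.
    rewrite -ler_pdivrMr// -exprVn; near: m.
    exact: (cvgr_le _ lim _ e8).
  have h2 : fluctuation (fun k => (k.+1 - S.+1)%N%:R) (2 ^ m) <= e / 8 * 2 ^+ m.
    rewrite -ler_pdivrMr//; near: m.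
    exact: (cvgr_le _ (lln_excess S.+1) _ e8).
  have := bad (2 ^ m)%N; rewrite -(ler_nat R) => h; apply: (le_trans h); rewrite natrD natr_sum.
  pose f k : R := (k.+1 - S.+1)%N%:R.
  rewrite (_ : \sum_(i < _) _ = Z (2 ^ m) * mean p f + fluctuation f (2 ^ m)); last first.
    by rewrite -fluctuationE; apply: eq_bigr => i _; rewrite /f; case: ifP.
  have h3 : Z (2 ^ m) * mean p f <= 2 ^+ m * (e / 8).
    apply: ler_pM => //.
    - by rewrite sumr_ge0.
    - have f0 k : 0 <= f k by [].
      rewrite -lee_fin -(meanE f0 (excess_le S.+1)) nneseries_ge0// => k _ _.
      by rewrite lee_fin mulr_ge0.
    - by rewrite (le_trans (Z_le _))// natrX.
    - by rewrite (le_trans (mean_excess_le _)).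
  move: h1 h2 h3; move: (2 ^+ m) m0 => y y0; nra.
exists (2 ^ m1)%N => // n /= mn.
have n0 : (0 < n)%N by apply: leq_trans mn; rewrite expn_gt0.
pose m := trunc_log 2 n.
have /andP[mn1 mn2] := trunc_log_bounds (ltnSn 1) n0.
have m1m : (m1 <= m)%N by rewrite /m -(trunc_expnK m1 (ltnSn 1)) leq_trunc_log.
(* Between powers of two, compare with the next power, which is at most [2 n]; this turns [e / 2]
   into [e]. *)
apply: (@le_trans _ _ (inadmissible_count (2 ^ m.+1))%:R).
  rewrite ler_nat /inadmissible_count (@big_cat_nat _ _ _ n _ (2 ^ m.+1))//=.
    exact: leq_addr.
  exact: ltnW.
apply: (le_trans (dyadic _ _)); first exact: leqW.
rewrite exprS mulrA divfK// ler_pM2l// -natrX ler_nat.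
exact: mn1.
Unshelve. all: by end_near. Qed.

(** Otherwise at least half of the first [k >= 2 n.+1] times would be inadmissible, against the
    density bound 1/3. *)
Lemma admissible_unbounded n : exists2 t, (n < t)%N & admissible gamma x t.
Proof.
have e0 : 0 < 1 / 3 :> R by lra.
have [n1 _ h] := inadmissible_density e0.
pose k := maxn n1 (2 * n.+1).
apply/not_exists2P => nadm.
have := h k (leq_maxl _ _); rewrite /inadmissible_count.
rewrite (@big_cat_nat _ _ _ n.+1)//=; last by rewrite /k; lia.
rewrite [X in (_ + X)%N](_ : _ = k - n.+1)%N; last first.
  rewrite -[RHS]muln1 -sum_nat_const_nat big_nat [RHS]big_nat.
  by apply: eq_bigr => t /andP[nt _]; case: asboolP => // ta; have [] := nadm t.
have kn : (2 * n.+1 <= k)%N by exact: leq_maxr.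
have : (k <= 2 * (\sum_(0 <= i < n.+1) ~~ `[< admissible gamma x i >] + (k - n.+1)))%N by lia.
rewrite -(ler_nat R) natrM => h1 h2.
have : 0 < k%:R :> R by rewrite ltr0n; lia.
lra.
Qed.

Lemma lambda_starS n (lam := lambda_star gamma x) :
  [/\ (lam n < lam n.+1)%N, admissible gamma x (lam n.+1) &
    forall t, (lam n < t < lam n.+1)%N -> ~ admissible gamma x t].
Proof.
have [t nt ta] := admissible_unbounded (lam n).
have [[h1 h2] h3] := leastP (conj nt ta :
  [set t | (lambda_star gamma x n < t)%N /\ admissible gamma x t] t).
split=> // t' /andP[nt' t'n] ta'.
by have := h3 t' (conj nt' ta'); rewrite leqNgt t'n.
Qed.

Lemma lambda_star_ge n : (n <= lambda_star gamma x n)%N.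
Proof. by elim: n => // n IH; have [h _ _] := lambda_starS n; exact: leq_ltn_trans h. Qed.

(** Every time skipped between consecutive stopping times is inadmissible. *)
Lemma lambda_star_le n (lam := lambda_star gamma x) :
  (lam n <= N 0 + n + inadmissible_count (lam n))%N.
Proof.
elim: n => [|n IH]; first by rewrite /lam/= (psiE N_step xE); lia.
have [h1 _ h3] := lambda_starS n; rewrite -/lam in h1 h3.
have : (inadmissible_count (lam n) + (lam n.+1 - (lam n).+1) <= inadmissible_count (lam n.+1))%N.
  rewrite {2}/inadmissible_count (@big_cat_nat _ _ _ (lam n).+1)//= leq_add//.
    by rewrite big_nat_recr//= leq_addr.
  rewrite -[leqLHS]muln1 -sum_nat_const_nat big_nat [leqRHS]big_nat leq_sum// => t nt.
  by case: asboolP => // /(h3 _ nt).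
lia.
Qed.

Lemma lambda_star_ratio :
  (lambda_star gamma x n)%:R / n%:R @[n --> \oo] --> (1 : R).
Proof.
apply/cvgrPdist_le => e e0.
(* The stopping time [l] satisfies [l <= N 0 + n + h l]. First [h <= 1/2] gives [l <= 2 (N 0 + n)];
   reinserting this with [h <= e / 8] bounds [l - n] by [e n]. *)
pose h : R := Num.min (1 / 2) (e / 8).
have h0 : 0 < h by rewrite lt_min; apply/andP; split; lra.
have [h12 h8] : h <= 1 / 2 /\ h <= e / 8 by rewrite !ge_min !lexx orbT.
have [n1 _ dens] := inadmissible_density h0.
pose n2 := Num.truncn (8 * (N 0%N)%:R / e).
near=> n.
have n1n : (n1 <= n)%N by near: n; exact: nbhs_infty_ge.
have n2n : (n2.+1 <= n)%N by near: n; exact: nbhs_infty_ge.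
have n0 : 0 < n%:R :> R by rewrite ltr0n; lia.
have Nn : (N 0%N)%:R <= e / 8 * n%:R.
  have : 8 * (N 0%N)%:R / e < n%:R.
    by rewrite (lt_le_trans (truncnS_gt _))// ler_nat.
  by rewrite ltr_pdivrMr//; lra.
set l := lambda_star gamma x n.
have lge : (n <= l)%N := lambda_star_ge n.
have lle : (l <= N 0 + n + inadmissible_count l)%N := lambda_star_le n.
have := dens l (leq_trans n1n lge).
move: lle lge; rewrite -!(ler_nat R) !natrD.
move: (l%:R) ((inadmissible_count l)%:R) => y b yle yge be.
rewrite distrC ger0_norm; last by rewrite subr_ge0 ler_pdivlMr// mul1r.
rewrite lerBlDr ler_pdivrMr// mulrDl mul1r.
have hy : h * y <= 1 / 2 * y by rewrite ler_wpM2r//; lra.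
have : h * y <= h * (2 * ((N 0%N)%:R + n%:R)) by rewrite ler_pM2l//; lra.
have : h * (N 0%N)%:R <= 1 / 2 * (N 0%N)%:R by rewrite ler_wpM2r.
have : h * n%:R <= e / 8 * n%:R by rewrite ler_wpM2r.
lra.
Unshelve. all: by end_near. Qed.

End density.

(** * Conditional mean of the current run *)

(** Positive values of [sigma] are read off finitely many symbols. The value 0 is left out, being
    also the default for an endless run. *)
Lemma sigma_succE (x : nat -> bool) i l :
  sigma x i = l.+1 <-> ones_after x i l.+1 /\ x (i + l.+2)%N = false.
Proof.
rewrite /sigma; set A := mkset _; split=> [|[h xl]].
  case: xgetP => // y -> [h1 h2] yl; rewrite {}yl in h1 h2; split=> //.
  apply/negP => xl; have : (l.+2 <= l.+1)%N; last by rewrite ltnn.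
  apply: h2 => j /andP[ij]; rewrite addnS leq_eqVlt ltnS => /predU1P[->|jl].
    by rewrite -addnS.
  by apply: h1; rewrite ij.
apply: xget_unique => [|y [y1 y2]].
  split=> // l' hl'; rewrite leqNgt; apply/negP => ll'.
  by have := hl' (i + l.+2)%N; rewrite xl => H; have : false by apply: H; lia.
apply/eqP; rewrite eqn_leq y2// andbT leqNgt; apply/negP => ly.
by have := y1 (i + l.+2)%N; rewrite xl => H; have : false by apply: H; lia.
Qed.

Section conditional_mean.
Context d (T : measurableType d) (R : realType) (P : probability T R).
Variables (p : nat -> R) (q : nat -> R) (M : nat -> {RV P >-> nat}) (C : R).
Variable X : nat -> T -> bool.
Hypotheses (hp : prob_mass p) (hM : markov_chain q (renewal_trans p) M).
Hypothesis hC : (\sum_(k <oo) (k.+1%:R ^+ 2 * p k)%:E = C%:E)%E.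
Hypothesis XE : forall n w, X n w = (M n w != 0%N).

Let p0 k : 0 <= p k. Proof. by have [] := hp. Qed.

(** Singles out the paths on which the countdown and the positivity of [p] at each opened run hold
    without exception, so that the remaining analysis is pathwise. *)
Definition regular_path (w : T) : Prop :=
  forall n, renewal_trans p (M n w) (M n.+1 w) != 0.

Lemma regular_path_ae : {ae P, forall w, regular_path w}.
Proof.
by apply: (markov_trans_ae hM) => i j; exact: renewal_trans_ge0.
Qed.

Lemma regular_path_step w : regular_path w ->
  forall n, (0 < M n w)%N -> M n.+1 w = (M n w).-1.
Proof.
move=> rw n Mn; have := rw n; case: (M n w) Mn => // k _ /=.
by case: (M n.+1 w =P k) => //; rewrite eqxx.
Qed.

Lemma regular_path_run w : regular_path w ->
  forall n, M n w = 0%N -> p (M n.+1 w) != 0.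
Proof. by move=> rw n Mn; have := rw n; rewrite Mn. Qed.

Lemma measurable_sigma n : measurable_fun setT (fun w => sigma (X^~ w) n).
Proof.
have m1 l : measurable [set w | sigma (X^~ w) n = l.+1].
  pose F w := `[< ones_after (X^~ w) n l.+1 /\ X (n + l.+2)%N w = false >].
  have aF : adapted M (n + l.+2) F.
    move=> w w' ww'; have XX j : (j <= n + l.+2)%N -> X j w = X j w'.
      by move=> jn; rewrite !XE ww'.
    apply/asbool_equiv_eq; rewrite XX//; split=> -[h ->]; split=> // j jl.
      by rewrite -XX ?h//; lia.
    by rewrite XX ?h//; lia.
  have := @adapted_measurable _ _ _ _ M _ bool (n + l.+2) F aF measurableT [set true] I.
  rewrite setTI; congr measurable; apply/seteqP; split=> w /=.
    by move=> /asboolP/sigma_succE.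
  by move=> /sigma_succE h; apply/asboolP.
(* The value 0, default included, is the complement of the positive ones. *)
have m0 : measurable [set w | sigma (X^~ w) n = 0%N].
  rewrite (_ : mkset _ = ~` \bigcup_l [set w | sigma (X^~ w) n = l.+1]).
    by apply: measurableC; exact: bigcup_measurable.
  apply/seteqP; split=> w /= h; first by move=> [l _ /=]; rewrite h.
  by case E : (sigma _ _) => [//|l]; exfalso; apply: h; exists l.
move=> _ Y _; rewrite setTI.
rewrite (_ : _ @^-1` _ = \bigcup_(c in Y) [set w | sigma (X^~ w) n = c]); last first.
  apply/seteqP; split=> [w Yw|w [c Yc /= wc]]; last by rewrite /preimage/= wc.
  by exists (sigma (X^~ w) n).
by apply: bigcup_measurable => -[|l] _.
Qed.

Definition word_atom (n : nat) (v : T) : set T :=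
  [set w | forall j, (j <= n)%N -> X j w = X j v].

Lemma adapted_word_atom n v : adapted M n (fun w => `[< word_atom n v w >]).
Proof.
move=> w w' ww'; apply/asbool_equiv_eq; split=> h j jn.
  by rewrite -h// !XE ww'.
by rewrite -h// !XE ww'.
Qed.

Lemma measurable_word_atom n v : measurable (word_atom n v).
Proof.
have := @adapted_measurable _ _ _ _ M _ bool n _ (@adapted_word_atom n v) measurableT [set true] I.
by rewrite setTI; congr measurable; apply/seteqP; split=> w /= /asboolP.
Qed.

Lemma history_atom n v : history X n (word_atom n v).
Proof.
exists [set [ffun i : 'I_n.+1 => X i v]] => //; rewrite setTI.
apply/seteqP; split=> w /=.
  by move=> /ffunP h j jn; have := h (Ordinal (jn : (j < n.+1)%N)); rewrite !ffunE.
by move=> h; apply/ffunP => i; rewrite !ffunE h// -ltnS.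
Qed.

Lemma history_atom_sub n (B : set T) v : history X n B -> B v -> word_atom n v `<=` B.
Proof.
move=> [S _ <-] [_ Sv] w wv; split=> //=; rewrite (_ : finfun _ = [ffun i : 'I_n.+1 => X i v])//.
by apply/ffunP => i; rewrite !ffunE wv// -ltnS.
Qed.

Let age w s n := age_is (fun j => M j w) s n.

(** The last [s] symbols of the word are 1, so after the last zero it records only that the run
    opened there has length at least [s]. The atom thus takes the form of a [renewal_term]. *)
Lemma word_atom_age n s v w : regular_path v -> regular_path w -> age v s n ->
  word_atom n v w <-> [/\ word_atom (n - s) v w, M (n - s)%N w = 0%N & (s <= M (n - s).+1 w)%N].
Proof.
move=> rv rw av; have sv := regular_path_step rv; have sw := regular_path_step rw.
have /(age_isP sv (XE^~ v))[sn xv hv] := av.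
split=> [wv|[wv Mw sM]].
  have : age w s n.
    apply/(age_isP sw (XE^~ w)); split=> // [|i ij]; first by rewrite wv// leq_subr.
    by rewrite wv ?hv//; lia.
  move=> /and3P[_ /eqP Mw sM]; split=> // j jn; apply: wv; lia.
have : age w s n by rewrite /age /age_is sn Mw eqxx.
move=> /(age_isP sw (XE^~ w))[_ xw hw] j jn.
have [jns|jns] := leqP j (n - s); first exact: wv.
by rewrite hw ?hv//; lia.
Qed.

Lemma cond_mean_summable s :
  (\sum_(l <oo) (l%:R * cond_law p s l)%:E)%E \is a fin_num.
Proof.
rewrite ge0_fin_numE; last first.
  by apply: nneseries_ge0 => l _ _; rewrite lee_fin mulr_ge0// cond_law_ge0.
have ti : 0 <= (tail_sum p s)^-1 by rewrite invr_ge0 tail_sum_ge0.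
apply: (@le_lt_trans _ _ ((tail_sum p s)^-1%:E * C%:E)%E); last by rewrite -EFinM ltry.
pose u k : \bar R := (k.+1%:R ^+ 2 * p k)%:E.
have u0 k : (0 <= u k)%E by rewrite lee_fin mulr_ge0// sqr_ge0.
apply: (@le_trans _ _ ((tail_sum p s)^-1%:E * \sum_(l <oo) u (l + s)%N)%E); last first.
  by apply: lee_wpmul2l => //; rewrite -hC; exact: (@nneseries_addn_le _ u).
rewrite -(@nneseriesZl _ _ xpredT)//.
apply: lee_nneseries => l _; first by move=> _; rewrite lee_fin mulr_ge0// cond_law_ge0.
rewrite -EFinM lee_fin /cond_law mulrA mulrC ler_wpM2l// ler_wpM2r//.
by rewrite -natrX ler_nat; nia.
Qed.

Definition cond_mean (s : nat) : R := fine (\sum_(l <oo) (l%:R * cond_law p s l)%:E)%E.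

Lemma cond_meanE s :
  (\sum_(l <oo) (l%:R * cond_law p s l)%:E = (cond_mean s)%:E)%E.
Proof. by rewrite fineK// cond_mean_summable. Qed.

Lemma excess_mean s :
  (\sum_(k <oo) ((k - s)%N%:R * p k)%:E = (cond_mean s * tail_sum p s)%:E)%E.
Proof.
rewrite (@nneseries_split _ _ 0 s); last by move=> k _; rewrite lee_fin mulr_ge0.
rewrite add0n big_nat big1 ?add0e => [|k /andP[_ ks]]; last first.
  by rewrite (_ : k - s = 0)%N ?mul0r//; lia.
rewrite -(@nneseries_addn _ (fun k => ((k - s)%N%:R * p k)%:E)); last first.
  by move=> k; rewrite lee_fin mulr_ge0.
rewrite mulrC EFinM -cond_meanE -(@nneseriesZl _ _ xpredT); last first.
  by move=> l _; rewrite lee_fin mulr_ge0// cond_law_ge0.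
apply: eq_eseriesr => l _; rewrite addnK -(cond_lawM hp) -EFinM; congr EFin; ring.
Qed.

(* Both integrands depend on the run opened by the last zero before [n], which
   is independent of the past. *)
Lemma integral_word_atom n s v : regular_path v -> age v s n ->
  (\int[P]_(w in word_atom n v) (sigma (X^~ w) n)%:R%:E =
   (cond_mean s)%:E * P (word_atom n v))%E.
Proof.
move=> rv av; pose i := (n - s)%N.
have sn : (s <= n)%N by have /and3P[] := av.
pose a (j : nat) w := `[< word_atom j v w >].
have aa : adapted M i (a i) := @adapted_word_atom i v.
have aT (h : nat -> R) : measurable_fun setT (fun w => (renewal_term M a h i w)%:E : \bar R).
  apply: (@adapted_measurable _ _ _ _ M _ _ i.+1) => w w' ww'.
  by rewrite (@adapted_renewal_term _ _ _ _ _ a h i aa w w').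
have mA : measurable (word_atom n v) by exact: measurable_word_atom.
have ms : measurable_fun setT (fun w => (sigma (X^~ w) n)%:R%:E : \bar R).
  by apply: (measurableT_comp (f := fun k : nat => k%:R%:E : \bar R)) => //; exact: measurable_sigma.
have E1 : (\int[P]_(w in word_atom n v) (sigma (X^~ w) n)%:R%:E =
    \int[P]_w (renewal_term M a (fun k => (k - s)%N%:R) i w)%:E)%E.
  rewrite integral_mkcond; apply: ge0_ae_eq_integral => //.
  - by apply/(measurable_restrictT _ _).1 => //; exact: measurable_funS ms.
  - by move=> w _; apply: erestrict_ge0 => ? _; rewrite lee_fin.
  - by move=> w _; rewrite lee_fin /renewal_term; case: ifP.
  have := regular_path_ae; apply: filterS => w rw _.
  rewrite patchE /renewal_term /a -/i.
  have sw := regular_path_step rw.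
  have [wA|wA] := pselect (word_atom n v w).
    rewrite mem_set//; have /(word_atom_age rv rw av)[wi Mi sM] := wA.
    rewrite asboolT//= Mi eqxx.
    rewrite (age_is_sigma sw (XE^~ w) (_ : age_is _ s n))//.
    by rewrite /age_is sn Mi eqxx.
  (* Off the atom, with the same past and a zero at [i], the run is shorter than [s] and truncated
     subtraction gives 0. *)
  rewrite memNset//; case: ifP => // /andP[/asboolP wi /eqP Mi].
  have : ~~ (s <= M i.+1 w)%N.
    by apply/negP => sM; apply: wA; apply/(word_atom_age rv rw av).
  by rewrite -ltnNge => sM; rewrite (_ : _ - s = 0)%N//; lia.
have E2 : (P (word_atom n v) =
    \int[P]_w (renewal_term M a (fun k => (s <= k)%N%:R) i w)%:E)%E.
  rewrite -[word_atom n v]setIT -integral_indic//.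
  apply: ge0_ae_eq_integral => //.
  - by apply/measurable_EFinP; exact: measurable_indic.
  - by move=> w _; rewrite lee_fin /renewal_term; case: ifP.
  have := regular_path_ae; apply: filterS => w rw _.
  rewrite indicE /renewal_term /a -/i.
  have [wA|wA] := pselect (word_atom n v w).
    rewrite mem_set//; have /(word_atom_age rv rw av)[wi Mi sM] := wA.
    by rewrite asboolT//= Mi eqxx sM.
  rewrite memNset//; case: ifP => // /andP[/asboolP wi /eqP Mi].
  have : ~~ (s <= M i.+1 w)%N.
    by apply/negP => sM; apply: wA; apply/(word_atom_age rv rw av).
  by move=> /negPf ->.
rewrite E1 E2 (renewal_term_integral hp hM aa _ (excess_mean s))//.
rewrite (renewal_term_integral hp hM aa _ (tail_sum_indicator hp s))//.
have cm0 : 0 <= cond_mean s.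
  by rewrite fine_ge0// nneseries_ge0// => l _ _; rewrite lee_fin mulr_ge0// cond_law_ge0.
rewrite -ge0_integralZl//; last 2 first.
- apply: (@adapted_measurable _ _ _ _ M _ _ i) => w w' ww'.
  by rewrite (aa w w')// ww'.
- by move=> w _; rewrite lee_fin; case: ifP; rewrite ?tail_sum_ge0.
by apply: eq_integral => w _; rewrite -EFinM; case: ifP; rewrite ?mulr0.
Qed.

(** The null atoms form a countable union; quantifying over codes lets [ae_foralln] handle it. *)
Lemma word_atom_pos_ae n : {ae P, forall w, P (word_atom n w) != 0%E}.
Proof.
pose code w : nat := pickle [ffun i : 'I_n.+1 => X i w].
have codeE v w : code w = code v -> word_atom n v w.
  move=> /(pcan_inj pickleK)/ffunP h j jn.
  by have := h (Ordinal (jn : (j < n.+1)%N)); rewrite !ffunE.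
have atomE v w : word_atom n v w -> word_atom n v = word_atom n w.
  by move=> vw; apply/seteqP; split=> u h j jn; rewrite h// vw.
suff : {ae P, forall w c, code w = c -> P (word_atom n w) != 0%E}.
  by apply: filterS => w /(_ _ erefl).
apply: ae_foralln => c.
have [[v vc v0]|nv] := pselect (exists2 v, code v = c & P (word_atom n v) = 0%E).
  exists (word_atom n v); split=> //; first exact: measurable_word_atom.
  by move=> w /= /not_implyP[wc _]; apply: codeE; rewrite wc vc.
apply: aeW => w wc; apply/eqP => w0; apply: nv; exists w => //.
Qed.

(** A version of the conditional expectation is constant on each atom of the history, and its
    integral over an atom of positive probability determines the constant. *)
Lemma cond_expectation_sigma theta n :
  cond_expectation P (history X n) (fun w => (sigma (X^~ w) n)%:R) theta ->
  {ae P, forall w, (M 0%N w <= n)%N -> theta w = cond_mean (tau (X^~ w) n)}.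
Proof.
move=> [mt it et].
have := regular_path_ae; have := word_atom_pos_ae n.
apply: filterS2 => v Pv rv Mv.
have sv := regular_path_step rv.
have av : age v (tau (X^~ v) n) n by rewrite /age -(tauE sv (XE^~ v)).
have cst_theta w : word_atom n v w -> theta w = theta v.
  exact: (history_atom_sub (mt _ (measurable_set1 (theta v))) erefl).
have mA := measurable_word_atom n v.
have E : ((theta v)%:E * P (word_atom n v) =
    (cond_mean (tau (X^~ v) n))%:E * P (word_atom n v))%E.
  rewrite -(integral_word_atom rv av) -et; last exact: history_atom.
  rewrite -integral_cst//; apply: eq_integral => w.
  by rewrite inE => /cst_theta ->.
have Pfin : P (word_atom n v) \is a fin_num by exact: fin_num_measure.
move: E Pv; rewrite -(fineK Pfin) -!EFinM eqe => -[E] r0.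
exact: mulIf r0 _ _ E.
Qed.

End conditional_mean.

(** * Error of the mean, the moment condition, and conclusion *)

Lemma h_star_dist (R : realType) (gamma : R) (x : nat -> bool) (t : nat)
    (q : nat -> R) (h : R) :
  (forall l, 0 <= q l) -> (\sum_(l <oo) (l%:R * q l)%:E = h%:E)%E ->
  (`| h_star gamma x t - h |%:E <=
   \sum_(l <oo) (l.+1%:R * `|phat_star gamma x t l - q l|)%:E)%E.
Proof.
move=> q0 qh.
set S := (X in (_ <= X)%E).
have le_S L : ((\sum_(0 <= l < L) l.+1%:R * `|phat_star gamma x t l - q l|)%:E <= S)%E.
  by rewrite -sumEFin; apply: nneseries_lim_ge => l _; rewrite lee_fin mulr_ge0.
have [Sfin|] := boolP (S \is a fin_num); last first.
  rewrite ge0_fin_numE; first by rewrite -leNgt leye_eq => /eqP ->; rewrite leey.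
  by apply: nneseries_ge0 => l _ _; rewrite lee_fin mulr_ge0.
rewrite -(fineK Sfin) lee_fin.
have hq : series (fun l => l%:R * q l) @ \oo --> h.
  by apply: EFin_cvg_series => // l; rewrite mulr_ge0.
pose c : R := ((Num.ceil (quota gamma t))%:~R)^-1.
pose K := kappa_star gamma x t.
(* [h_star] is the mean of [phat_star]: the partial sums are constant once they pass the longest run
   in the sample. *)
have ph : series (fun l => l%:R * phat_star gamma x t l) @ \oo --> h_star gamma x t.
  apply: cvg_near_cst; exists (\max_(i < K.+1) sigma x i).+1 => // L /= KL.
  rewrite /series/= /phat_star /h_star -/K -/c.
  under eq_bigr do rewrite mulrCA.
  rewrite -mulr_sumr; congr (_ * _); under eq_bigr do rewrite mulr_sumr.
  rewrite exchange_big_nat/= big_nat [RHS]big_nat; apply: eq_bigr => i /andP[_ iK].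
  have sL : (sigma x i < L)%N.
    by apply: leq_trans KL; rewrite ltnS (leq_bigmax (Ordinal iK)).
  rewrite (bigD1_seq (sigma x i)) ?iota_uniq ?mem_index_iota//= eqxx andbT mulrC.
  by rewrite big1 ?addr0// => l /negPf li; rewrite [sigma x i == l]eq_sym li andbF mulr0.
apply: (cvgr_to_le (cvg_norm (cvgB ph hq))); apply: nearW => L.
rewrite -lee_fin fineK//; apply: le_trans (le_S L); rewrite lee_fin.
rewrite !fctE /series/= -sumrB (le_trans (ler_norm_sum _ _ _))// ler_sum// => l _.
by rewrite -mulrBr normrM ger0_norm// ler_wpM2r// ler_nat.
Qed.

(** As [alpha + 1 > 2], [(k + 1)^2 <= 4 k^2 <= 4 k^(alpha + 1)] for [k >= 1]; the extra summand
    [p k] covers [k = 0]. *)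
Lemma second_moment (R : realType) (p : nat -> R) (alpha : R) :
  prob_mass p -> 1 < alpha ->
  (\sum_(k <oo) (k%:R `^ (alpha + 1) * p k)%:E < +oo)%E ->
  exists C : R, (\sum_(k <oo) (k.+1%:R ^+ 2 * p k)%:E = C%:E)%E.
Proof.
move=> [p0 p1] a1 mom.
suff fin : (\sum_(k <oo) (k.+1%:R ^+ 2 * p k)%:E)%E \is a fin_num.
  by exists (fine (\sum_(k <oo) (k.+1%:R ^+ 2 * p k)%:E)%E); rewrite fineK.
rewrite ge0_fin_numE; last first.
  by apply: nneseries_ge0 => k _ _; rewrite lee_fin mulr_ge0// sqr_ge0.
have u0 k : (0 <= (k%:R `^ (alpha + 1) * p k)%:E)%E.
  by rewrite lee_fin mulr_ge0// powR_ge0.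
apply: (@le_lt_trans _ _ (\sum_(k <oo) ((p k)%:E + 4%:E * (k%:R `^ (alpha + 1) * p k)%:E))%E).
  apply: lee_nneseries => k _; first by move=> _; rewrite lee_fin mulr_ge0// sqr_ge0.
  rewrite -EFinM -EFinD lee_fin mulrA -[X in _ <= X + _]mul1r -mulrDl ler_wpM2r//.
  case: k => [|k]; first by rewrite expr1n lerDl mulr_ge0// powR_ge0.
  have k1 : 1 <= k.+1%:R :> R by rewrite ler1n.
  have : k.+1%:R ^+ 2 <= k.+1%:R `^ (alpha + 1) :> R.
    by rewrite -powR_mulrn// ler_powR//; lra.
  rewrite -[k.+2%:R]natr1; move: (k.+1%:R) k1 => y y1; nra.
rewrite nneseriesD; last 2 first.
- by move=> k _; rewrite lee_fin.
- by move=> k _; rewrite mule_ge0.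
rewrite p1 (@nneseriesZl _ _ xpredT)//; apply: lte_add_pinfty; first exact: ltry.
by apply: lte_mul_pinfty.
Qed.

Theorem theorem2 (d : measure_display) (T : measurableType d) (R : realType)
    (P : probability T R) (p : nat -> R) (X : nat -> T -> bool)
    (alpha gamma : R) (theta : nat -> T -> R)
    (hp : prob_mass p)
    (hmean : (\sum_(0 <= k <oo) (k%:R * p k)%:E < +oo)%E)
    (hX : binary_renewal P p X)
    (halpha : 1 < alpha)
    (hmoment : (\sum_(0 <= k <oo) (k%:R `^ (alpha + 1) * p k)%:E < +oo)%E)
    (hgamma0 : 0 < gamma) (hgamma1 : gamma < 1 / 3)
    (htheta : forall n : nat,
       cond_expectation P (history X n)
         (fun w => (sigma (X^~ w) n)%:R) (theta n)) :
  {ae P, forall w : T,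
    let x := X^~ w in
    let lam := lambda_star gamma x in
    [/\ (lam n)%:R / n%:R @[n --> \oo] --> (1 : R),
        `| h_star gamma x (lam n) - theta (lam n) w | @[n --> \oo] --> (0 : R)
      & (\sum_(0 <= l <oo)
           `| phat_star gamma x (lam n) l
              - p (l + tau x (lam n))%N / tail_sum p (tau x (lam n)) |%:E)%E
          @[n --> \oo] --> (0 : \bar R)%E]}.
Proof.
have [C hC] := second_moment hp halpha hmoment.
have [M [q [_ hM XE]]] := hX.
have visit1 s k : `|(s <= k)%N%:R : R| <= k.+1%:R.
  by rewrite ger0_norm// ler_nat; case: (s <= k)%N.
have excess1 j k : `|(k.+1 - j)%N%:R : R| <= k.+1%:R.
  by rewrite ger0_norm// ler_nat leq_subr.
have lln_visit := ae_foralln (fun s => strong_law_dyadic hp hM hC (visit1 s)).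
have lln_excess := ae_foralln (fun j => strong_law_dyadic hp hM hC (excess1 j)).
have mean_theta := ae_foralln (fun n =>
  cond_expectation_sigma hp hM hC XE (htheta n)).
(* Five almost sure events are intersected; from here on the path is fixed. *)
apply: filterS (filterI (regular_path_ae hp hM) (filterI lln_visit (filterI
  lln_excess (filterI mean_theta (sample_error_cvg0 hp hM hC hgamma1))))) => w [rw [vw [ew [tw sw]]]].
set x := X^~ w; set lam := lambda_star gamma x.
have step := regular_path_step rw.
have xE n : x n = (M n w != 0)%N by exact: XE.
have run := regular_path_run rw.
pose m n := flog R (lam n).
(* Since [lam n >= n], the scale [m n] tends to infinity, so convergence in [m] carries over to this
   random index. *)
have m_oo : m n @[n --> \oo] --> \oo.
  apply/cvgnyPge => A; exists (2 ^ A)%N => // n /= An; apply: flog_ge.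
  apply: (leq_trans An).
  exact: (@lambda_star_ge R p C gamma (fun n => M n w)).
have small : sample_error p M (m n) (sample_size gamma (m n)) w
    @[n --> \oo] --> (0 : \bar R)%E.
  exact: (cvg_comp _ _ m_oo sw).
pose E n : \bar R := (\sum_(l <oo) (l.+1%:R *
  `|phat_star gamma x (lam n) l - cond_law p (tau x (lam n)) l|)%:E)%E.
have E_le : \forall n \near \oo, (E n <= sample_error p M (m n) (sample_size gamma (m n)) w)%E /\
    theta (lam n) w = cond_mean p (tau x (lam n)).
  near=> n.
  (* The first zero then lies at or before [m n], so every position considered beyond it has a
     genuine age. *)
  have mn : (M 0%N w <= m n)%N by near: n; move/cvgnyPge : m_oo; exact.
  have n0 : (0 < n)%N by near: n; exact: nbhs_infty_gt.
  have adm : admissible gamma x (lam n).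
    rewrite -(prednK n0).
    by have [] := lambda_starS hp hC hgamma0 step run xE vw ew n.-1.
  have lam0 : (0 < lam n)%N.
    apply: (leq_trans n0).
    exact: (@lambda_star_ge R p C gamma (fun n => M n w)).
  split; first exact: phat_sample_error.
  apply: tw; apply: (leq_trans mn); rewrite /m.
  have /andP[ml _] := flog_itv R lam0.
  by apply: leq_trans ml; apply: ltnW; exact: ltn_expl.
have E0 : E n @[n --> \oo] --> (0 : \bar R)%E.
  apply: squeeze_cvge small; last exact: cvg_cst.
  apply: filterS E_le => n [-> _]; rewrite andbT.
  by apply: nneseries_ge0 => l _ _; rewrite lee_fin mulr_ge0.
split.
- exact: (@lambda_star_ratio R p C gamma (fun n => M n w)).
- have h : (`|h_star gamma x (lam n) - theta (lam n) w|%:E)%E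
      @[n --> \oo] --> (0 : \bar R)%E.
    apply: squeeze_cvge E0; last exact: cvg_cst.
    apply: filterS E_le => n [_ ->]; rewrite lee_fin normr_ge0/=.
    apply: h_star_dist; first by move=> l; exact: cond_law_ge0.
    exact: (cond_meanE hp hC).
  by move/fine_cvgP : h => [].
- apply: squeeze_cvge E0; last exact: cvg_cst.
  apply: nearW => n; rewrite nneseries_ge0/=; last by move=> l _ _; rewrite lee_fin.
  apply: lee_nneseries => l _; first by move=> _; rewrite lee_fin.
  by rewrite lee_fin ler_peMl// ler1n.
Unshelve. all: by end_near. Qed.
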